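(* Let $k/k_0$ be a function field of characteristic $p$ with perfect field of constants $k_0$, and let $f(X)=X^{p^n}+a_{n-1}X^{p^{n-1}}+\cdots+a_1X^p+a_0X\in k_0[X]$, $a_0\neq 0$, be a monic separable additive polynomial all of whose roots lie in $k_0$. Let $K=k(y)$ with $f(y)=u\in k$, where $f(X)-u\in k[X]$ is irreducible. Let $\mathcal{P}$ be a place of $k$. Then one can choose $u\in k$ (that is, one can choose the generator $y$ with $K=k(y)$ and $f(y)=u\in k$) such that either $v_{\mathcal{P}}(u)\geq 0$, or $v_{\mathcal{P}}(u)=-\lambda p^m$ with $\lambda\in\mathbb{N}$, $\gcd(\lambda,p)=1$ and $0\leq m<n$. In the first case $\mathcal{P}$ is unramified in $K/k$, and in the second case $\mathcal{P}$ is ramified in $K/k$ and $p^{n-m}\mid e_{\mathcal{P}}$.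
   Context: A polynomial $f$ is additive if $f(x+y)=f(x)+f(y)$ for all $x,y\in\bar k$. Under these hypotheses $K/k$ is a Galois extension of degree $p^n$. $v_{\mathcal{P}}$ denotes the normalized valuation of $k$ at $\mathcal{P}$ and $e_{\mathcal{P}}$ denotes the ramification index of $\mathcal{P}$ in $K/k$. *)

(* Defs.v *)
From HB Require Import structures.
From mathcomp Require Import all_boot all_order all_algebra all_field.
From mathcomp Require Import constructive_ereal.

Set Implicit Arguments.
Unset Strict Implicit.
Unset Printing Implicit Defensive.

Import Order.TTheory GRing.Theory Num.Theory.

Local Open Scope ring_scope.

Definition perfect_field (F : fieldType) : Prop :=
  forall q : {poly F}, irreducible_poly q -> separable_poly q.

(* A field extension is given by its embedding [iota : k0 -> k].  Elements of
   the rational subfield [k0(x)] of [k]. *)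
Definition in_rational_subfield (k0 k : fieldType) (iota : {rmorphism k0 -> k})
    (x z : k) : Prop :=
  exists q r : {poly k0}, (map_poly iota r).[x] != 0 /\
    z = (map_poly iota q).[x] / (map_poly iota r).[x].

(* [k / k0] is a function field in one variable whose full field of constants
   is [k0]: it is a finite extension of some [k0(x)] with [x] transcendental
   over [k0], and [k0] is algebraically closed in [k]. *)
Definition function_field (k0 k : fieldType) (iota : {rmorphism k0 -> k}) :
    Prop :=
  (exists x : k, ~ algebraicOver iota x /\
     exists (d : nat) (b : 'I_d -> k), forall z : k,
       exists c : 'I_d -> k,
         (forall i, in_rational_subfield iota x (c i)) /\
         z = \sum_(i < d) c i * b i) /\
  (forall z : k, algebraicOver iota z -> exists c : k0, z = iota c).

(* A place of [F / k0] is represented by its normalized discrete valuation,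
   with values in [int] extended by [v 0 = +oo]; the last axiom says that it is
   trivial on the constants.  The valuation ring is [0 <= v x] and its maximal
   ideal is [0 < v x]. *)
Record place (k0 F : fieldType) (iota : k0 -> F) := Place {
  valuation :> F -> \bar int;
  valuation0 : valuation 0 = +oo%E;
  valuation_fin_num : forall x, x != 0 -> valuation x \is a fin_num;
  valuationM : forall x y, valuation (x * y) = (valuation x + valuation y)%E;
  valuationD : forall x y,
    (Order.min (valuation x) (valuation y) <= valuation (x + y))%E;
  valuation_normalized : exists t, valuation t == 1%:E;
  valuation_constant : forall c : k0, c != 0 -> valuation (iota c) = 0%E
}.

Definition uniformizer (k0 F : fieldType) (iota : k0 -> F) (P : place iota) :
    F :=
  xchoose (valuation_normalized P).

Section Ramification.
Variables (k0 k : fieldType) (iota : {rmorphism k0 -> k}) (K : fieldExtType k).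

Definition place_above := place (fun c : k0 => (iota c)%:A : K).

Definition lies_over (Q : place_above) (P : place iota) : Prop :=
  forall x : k, (0 < Q (x%:A))%E = (0 < P x)%E.

(* [e(Q|P)], meaningful when [Q] lies over [P]: the integer [e] such that
   [Q (x%:A) = e * P x] for all nonzero [x : k]. *)
Definition ramification_index (Q : place_above) (P : place iota) : nat :=
  `|fine (Q ((uniformizer P)%:A))|%N.

(* No condition on residue fields is needed: their extensions are separable
   when [k0] is perfect. *)
Definition unramified (P : place iota) : Prop :=
  forall Q : place_above, lies_over Q P -> ramification_index Q P = 1%N.

Definition ramified (P : place iota) : Prop :=
  exists Q : place_above, lies_over Q P /\ (1 < ramification_index Q P)%N.

(* [K = k(y)] and [f(y) = u]. *)
Definition generated_by (f : {poly k0}) (y : K) (u : k) : Prop :=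
  <<1%VS; y>>%VS = {:K}%VS /\
  (map_poly (in_alg K) (map_poly iota f)).[y] = u%:A.

End Ramification.

Arguments unramified {k0 k iota} K P.
Arguments ramified {k0 k iota} K P.

(* [X^(p^n) + a_(n-1) X^(p^(n-1)) + ... + a_1 X^p + a_0 X]; in characteristic
   [p] this is the general monic additive polynomial of degree [p^n], and it is
   separable iff [a_0 != 0]. *)
Definition additive_polynomial (F : fieldType) (p n : nat) (a : 'I_n -> F) :
    {poly F} :=
  'X^(p ^ n) + \sum_(i < n) a i *: 'X^(p ^ i).

(* Main.v *)
Require Import Defs.
From HB Require Import structures.
From mathcomp Require Import all_boot all_order all_algebra all_field.
From mathcomp Require Import constructive_ereal boolp classical_sets.
From mathcomp Require Import zify ring generic_quotient.

Set Implicit Arguments.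
Unset Strict Implicit.
Unset Printing Implicit Defensive.

Import Order.TTheory GRing.Theory Num.Theory.

Local Open Scope ring_scope.

(** A good [u] exists because poles can be lowered: replacing [y] by [y - z]
    with [z] in [k] replaces [u] by [u - f(z)]. If the pole order of [u] is
    divisible by [p^n], then [u - z^(p^n)] has a smaller pole for a suitable
    [z] ([ppow_approximation]), and so has [u - f(z)], since [z^(p^n)]
    dominates the other terms of [f(z)]. The process stops at [v(u) >= 0] or
    at a pole of order [l p^m] with [m < n]. The approximation needs p-th
    roots modulo higher order. Instead of showing that the residue field is
    perfect, one uses that [k] has degree at most [p] over its subfield of
    p-th powers ([dependent_over_pth_powers], by counting equations and
    unknowns over [k0(x)]). Hence the powers [t^i], [i < p], of a
    uniformizer [t] form a basis over the p-th powers; the terms of an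
    expansion in this basis have valuations in distinct classes modulo [p],
    so when [p] divides [v(z)] the term with [i = 0], a p-th power, is the
    dominant one.

    When [u] is integral at [P], the reduction of [f - u] is separable, and
    this makes [P] unramified. Let [Q] lie over [P] with ramification index
    [e]. Then [y] is integral at [Q], and the roots [y + r] of [f - u] are
    pairwise distinct modulo the ideal of [Q], since the [r] are constants.
    It is shown that [e] divides the valuation of every [G(y)] with [G]
    integral ([ramification_index_dvd_ord]). If [G(y)] is in the ideal,
    there is an integral [T] such that [T(y)] is a unit and [G T] takes
    values in the ideal at all roots ([residual_cofactor]). By interpolation
    the remainder of [G T] modulo [f - u] has its coefficients in the ideal
    of [P] ([small_values_small_coefficients]), so a uniformizer of [P] can
    be divided out, which lowers the valuation by exactly [e]. As the value
    [1] is taken, [e = 1].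

    When [u] has a pole of order [l p^m], comparing the valuations of [f(y)]
    and [u] at [Q] gives [p^n v(y) = - e l p^m], whence [p^(n-m)] divides
    [e]. For [P] to be ramified some [Q] must lie over [P]
    ([exists_place_above]): a subring of [K] that is maximal among those
    containing the valuation ring of [P] in which a uniformizer stays
    non-invertible is a valuation ring, and it is discrete because the
    algebraic relations over [k] bound how often nonunits divide the
    uniformizer. *)

(** * Valuations *)

Section PlaceTheory.
Variables (k0 F : fieldType) (iota : k0 -> F) (P : place iota).
Implicit Types x y z : F.

(** Meaningful for nonzero arguments only: [fine] sends the value [+oo] at [0]
    to [0]. *)
Definition ord x : int := fine (P x).

Lemma placeE x : x != 0 -> P x = (ord x)%:E.
Proof. by move=> x0; rewrite /ord fineK // valuation_fin_num. Qed.

Lemma ordM x y : x != 0 -> y != 0 -> ord (x * y) = ord x + ord y.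
Proof.
by move=> x0 y0; rewrite /ord valuationM fineD // valuation_fin_num.
Qed.

Lemma ord1 : ord 1 = 0.
Proof.
by apply: (@addrI _ (ord 1)); rewrite -ordM ?oner_neq0 // mulr1 addr0.
Qed.

Lemma ordV x : x != 0 -> ord x^-1 = - ord x.
Proof.
move=> x0; apply: (@addrI _ (ord x)).
by rewrite -ordM ?invr_eq0 // divff // ord1 subrr.
Qed.

Lemma ordX x m : x != 0 -> ord (x ^+ m) = (ord x) *+ m.
Proof.
move=> x0; elim: m => [|m IH]; first by rewrite expr0 ord1.
by rewrite exprS ordM ?expf_neq0 // IH mulrS.
Qed.

Lemma ordN x : ord (- x) = ord x.
Proof.
case: (eqVneq x 0) => [->|x0]; first by rewrite oppr0.
have N1 : (-1 : F) != 0 by rewrite oppr_eq0 oner_eq0.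
have : ord (-1) + ord (-1) = 0 by rewrite -ordM // mulrNN mulr1 ord1.
move=> h; rewrite -mulN1r ordM //; suff -> : ord (-1) = 0 by rewrite add0r.
by lia.
Qed.

Lemma place_ge0 x : x != 0 -> (0 <= P x)%E = (0 <= ord x).
Proof. by move=> x0; rewrite placeE // lee_fin. Qed.

Lemma place_gt0 x : x != 0 -> (0 < P x)%E = (0 < ord x).
Proof. by move=> x0; rewrite placeE // lte_fin. Qed.

Lemma ordD x y : x != 0 -> y != 0 -> x + y != 0 ->
  Num.min (ord x) (ord y) <= ord (x + y).
Proof.
move=> x0 y0 xy0; have := valuationD P x y.
by rewrite !placeE // -EFin_min lee_fin.
Qed.

Lemma ordD_lt x y : x != 0 -> y != 0 -> ord x < ord y ->
  x + y != 0 /\ ord (x + y) = ord x.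
Proof.
move=> x0 y0 lt_xy.
have xy0 : x + y != 0.
  by apply: contraTneq lt_xy => /eqP; rewrite addr_eq0 => /eqP->; rewrite ordN ltxx.
split=> //; have := ordD x0 y0 xy0.
have Ny0 : - y != 0 by rewrite oppr_eq0.
have := ordD xy0 Ny0; rewrite addrK => /(_ x0); rewrite ordN; lia.
Qed.

Definition vring : {pred F} := [pred x | (0 <= P x)%E].
Definition videal : {pred F} := [pred x | (0 < P x)%E].

Lemma vringE x : x != 0 -> (x \in vring) = (0 <= ord x).
Proof. exact: place_ge0. Qed.

Lemma videalE x : x != 0 -> (x \in videal) = (0 < ord x).
Proof. exact: place_gt0. Qed.

Lemma vring0 : 0 \in vring.
Proof. by rewrite inE valuation0 leey. Qed.

Lemma videal0 : 0 \in videal.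
Proof. by rewrite inE valuation0 ltry. Qed.

Lemma vring1 : 1 \in vring.
Proof. by rewrite vringE ?oner_neq0 // ord1. Qed.

Lemma vringM : {in vring &, forall x y, x * y \in vring}.
Proof. by move=> x y; rewrite !inE valuationM; apply: adde_ge0. Qed.

Lemma vringD : {in vring &, forall x y, x + y \in vring}.
Proof.
move=> x y; rewrite !inE => hx hy; apply: le_trans (valuationD P x y).
by rewrite le_min hx hy.
Qed.

Lemma videalD : {in videal &, forall x y, x + y \in videal}.
Proof.
move=> x y; rewrite !inE => hx hy; apply: lt_le_trans (valuationD P x y).
by rewrite lt_min hx hy.
Qed.

Lemma vringN x : x \in vring -> - x \in vring.
Proof.
case: (eqVneq x 0) => [->|x0]; first by rewrite oppr0.
by rewrite !vringE ?oppr_eq0 // ordN.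
Qed.

Lemma videalN x : x \in videal -> - x \in videal.
Proof.
case: (eqVneq x 0) => [->|x0]; first by rewrite oppr0.
by rewrite !videalE ?oppr_eq0 // ordN.
Qed.

Lemma vring_subring_closed : subring_closed vring.
Proof.
split; [exact: vring1 | move=> x y hx hy | exact: vringM].
by apply: vringD => //; apply: vringN.
Qed.
HB.instance Definition _ := GRing.isSubringClosed.Build F vring vring_subring_closed.

Lemma videal_zmod_closed : zmod_closed videal.
Proof.
by split=> [|x y hx hy]; [exact: videal0 | apply: videalD => //; apply: videalN].
Qed.
HB.instance Definition _ := GRing.isZmodClosed.Build F videal videal_zmod_closed.

Lemma videal_sub x : x \in videal -> x \in vring.
Proof. by rewrite !inE; apply: ltW. Qed.

Lemma videalMl x y : x \in vring -> y \in videal -> x * y \in videal.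
Proof.
case: (eqVneq x 0) => [->|x0]; first by rewrite mul0r videal0.
case: (eqVneq y 0) => [->|y0]; first by rewrite mulr0.
by rewrite vringE // !videalE ?mulf_neq0 // ordM //; lia.
Qed.

Lemma videalMr x y : x \in videal -> y \in vring -> x * y \in videal.
Proof. by rewrite mulrC => hx hy; apply: videalMl. Qed.

Lemma videalM x y : x \in vring -> y \in vring ->
  (x * y \in videal) = (x \in videal) || (y \in videal).
Proof.
case: (eqVneq x 0) => [->|x0]; first by rewrite mul0r !videal0.
case: (eqVneq y 0) => [->|y0]; first by rewrite mulr0 !videal0 orbT.
by rewrite !vringE // !videalE ?mulf_neq0 // ordM //; lia.
Qed.

Lemma ord_unit x : x \in vring -> x \notin videal -> x != 0 /\ ord x = 0.
Proof.
case: (eqVneq x 0) => [->|x0]; first by rewrite videal0.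
by rewrite vringE // videalE //; split=> //; lia.
Qed.

Lemma vringV x : x \in vring -> x \notin videal -> x^-1 \in vring.
Proof.
by move=> hx /(ord_unit hx) [x0 ox]; rewrite vringE ?invr_eq0 // ordV // ox.
Qed.

Lemma const_ord (c : k0) : c != 0 -> iota c != 0 -> ord (iota c) = 0.
Proof. by move=> c0 ic0; rewrite /ord valuation_constant. Qed.

Lemma uniformizerP : P (uniformizer P) = 1%:E.
Proof. by apply/eqP; exact: (xchooseP (valuation_normalized P)). Qed.

Lemma uniformizer_neq0 : uniformizer P != 0.
Proof.
by apply/eqP => h; have := uniformizerP; rewrite h valuation0.
Qed.

Lemma ord_uniformizer : ord (uniformizer P) = 1.
Proof. by rewrite /ord uniformizerP. Qed.

Lemma uniformizer_videal : uniformizer P \in videal.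
Proof. by rewrite videalE ?uniformizer_neq0 // ord_uniformizer. Qed.

Lemma videal_divuniformizer x : x \in videal -> x / uniformizer P \in vring.
Proof.
case: (eqVneq x 0) => [->|x0]; first by rewrite mul0r vring0.
have u0 := uniformizer_neq0.
rewrite videalE // vringE ?mulf_neq0 ?invr_eq0 // ordM ?invr_eq0 // ordV //.
by rewrite ord_uniformizer; lia.
Qed.

End PlaceTheory.

Section PlaceOrder.
Variables (k0 F : fieldType) (iota : k0 -> F) (P : place iota).
Implicit Types x y z : F.

Lemma place_lt x y : x != 0 -> y != 0 -> (P x < P y)%E = (ord P x < ord P y).
Proof. by move=> x0 y0; rewrite !placeE // lte_fin. Qed.

Lemma place_lt0 x : x != 0 -> (P x < P 0%R)%E.
Proof. by move=> x0; rewrite placeE // valuation0 ltry. Qed.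

Lemma place_ltD x y z : (P x < P y)%E -> (P x < P z)%E -> (P x < P (y + z)%R)%E.
Proof.
by move=> xy xz; apply: lt_le_trans (valuationD P y z); rewrite lt_min xy.
Qed.

Lemma placeN x : P (- x) = P x.
Proof.
case: (eqVneq x 0) => [->|x0]; first by rewrite oppr0.
by rewrite !placeE ?oppr_eq0 // ordN.
Qed.

Lemma ordD_place_lt x y : x != 0 -> (P x < P y)%E ->
  x + y != 0 /\ ord P (x + y) = ord P x.
Proof.
move=> x0; case: (eqVneq y 0) => [->|y0]; first by rewrite addr0.
by rewrite place_lt //; apply: ordD_lt.
Qed.

End PlaceOrder.

(** * Perfect fields and linear systems over a domain *)

Lemma exists_irreducible_divisor (F : fieldType) (g : {poly F}) :
  (1 < size g)%N -> exists2 q, irreducible_poly q & q %| g.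
Proof.
move=> g1.
have ex0 : exists m, `[< exists q : {poly F}, [/\ q %| g, (1 < size q)%N & size q = m] >].
  by exists (size g); apply/asboolP; exists g.
case: (ex_minnP ex0) => m /asboolP[q [qg q1 qm]] mmin.
exists q => //; split=> // r r1 rq.
have r0 : r != 0.
  by apply: contraTneq rq => ->; rewrite dvd0p -size_poly_gt0 ltnW.
have q0 : q != 0 by rewrite -size_poly_gt0 ltnW.
rewrite -dvdp_size_eqp //.
apply/eqP/anti_leq; rewrite dvdp_leq //= qm; apply: mmin; apply/asboolP.
exists r; split=> //; first exact: dvdp_trans qg.
by move: r0 r1; rewrite -size_poly_gt0; case: (size r) => [|[]].
Qed.

(** The polynomial [X^p - c] has derivative zero, so comparing derivatives in
    [X^p - c = q^e * s], with [q] a separable irreducible factor of exact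
    multiplicity [e], forces [p] to divide [e].  The degree leaves only [e = p]
    and [q] linear. *)
Lemma perfect_pth_root (F : fieldType) (p : nat) : p \in [pchar F] ->
  perfect_field F -> forall c : F, exists d, d ^+ p = c.
Proof.
move=> charp perfF c; have p_pr := pcharf_prime charp.
have p1 := prime_gt1 p_pr.
pose g : {poly F} := 'X^p - c%:P.
have szg : size g = p.+1 by rewrite size_XnsubC //; lia.
have g0 : g != 0 by rewrite -size_poly_gt0 szg.
have dg : g^`() = 0.
  rewrite derivB derivC derivXn subr0 -mulr_natr.
  by rewrite -polyC_natr (pcharf0 charp) polyC0 mulr0.
have [|q irrq qg] := @exists_irreducible_divisor _ g; first by rewrite szg; lia.
have q0 := irredp_neq0 irrq; have q1 := irrq.1.
have szX e : size (q ^+ e) = (e * (size q).-1).+1.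
  by rewrite mulnC -size_exp prednK // size_poly_gt0 expf_neq0.
have bnd e : q ^+ e %| g -> (e <= p)%N.
  move=> /dvdp_leq - /(_ g0); rewrite szX szg ltnS; apply: leq_trans.
  by rewrite -{1}[e]muln1 leq_mul2l; lia.
have ex1 : exists e, q ^+ e %| g by exists 1%N; rewrite expr1.
case: (ex_maxnP ex1 bnd) => e /dvdpP[s gE'] emax.
have {gE'}gE : g = s * q ^+ e := gE'.
have e0 : (0 < e)%N by apply: emax; rewrite expr1.
have qNs : ~~ (q %| s).
  apply/negP=> /dvdpP[t sE]; suff : (e.+1 <= e)%N by rewrite ltnn.
  by apply: emax; apply/dvdpP; exists t; rewrite gE sE exprS mulrA.
have qNq' : coprimep q q^`() by have := perfF q irrq; rewrite unlock.
have pe : (p %| e)%N.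
  apply: contraNT qNs => pNe.
  have : s^`() * q + s * q^`() *+ e = 0.
    have : (s^`() * q + s * q^`() *+ e) * q ^+ e.-1 = 0.
      rewrite -[RHS]dg gE derivM deriv_exp mulrDl mulrnAl mulrnAr !mulrA.
      by rewrite -[_ * q * _]mulrA -exprS prednK.
    by move/eqP; rewrite mulf_eq0 expf_eq0 (negPf q0) andbF orbF => /eqP.
  move/eqP; rewrite addrC addr_eq0 => /eqP hq.
  have : q %| s * q^`() *+ e by rewrite hq -mulNr dvdp_mull.
  rewrite -scaler_nat dvdpZr; last by rewrite -(dvdn_pcharf charp).
  by rewrite Gauss_dvdpl.
have szs : (0 < size s)%N.
  by rewrite size_poly_gt0; apply: contraNneq qNs => ->; rewrite dvdp0.
have sz : (size s + (e * (size q).-1) = p.+1)%N.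
  have s0 : s != 0 by rewrite -size_poly_gt0.
  by rewrite -szg gE size_mul ?expf_neq0 // szX addnS.
have q2 : size q = 2.
  by have := dvdn_leq e0 pe; nia.
have [x qx] := poly2_root q2.
exists x; apply/eqP; have /rootP : root g x.
  by rewrite -dvdp_XsubCl; apply: dvdp_trans qg; rewrite dvdp_XsubCl.
by rewrite /g !hornerE => /eqP; rewrite subr_eq0.
Qed.

Lemma fraction_quotient (D : idomainType) (x : {fraction D}) :
  exists n d : D, d != 0 /\ tofrac d * x = tofrac n.
Proof.
elim/quotW: x => x; exists \n_x, \d_x; split; first exact: denom_ratioP.
unlock tofrac; rewrite -[LHS]FracField.pi_mul; apply/eqmodP.
rewrite /= FracField.equivfE !numden_Ratio ?mulf_neq0 ?oner_neq0 ?denom_ratioP //.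
by rewrite !mulr1 !mul1r mulrC.
Qed.

(** A homogeneous system with more unknowns than equations: it is solved in
    the field of fractions, and the denominators are then cleared. *)
Lemma underdetermined_system (D : idomainType) (a b : nat) (M : 'M[D]_(a, b)) :
  (b < a)%N -> exists2 v : 'rV[D]_a, v != 0 & v *m M = 0.
Proof.
move=> ltba; pose Mf := map_mx (@tofrac D) M.
have : kermx Mf != 0.
  rewrite -mxrank_eq0 mxrank_ker -lt0n subn_gt0.
  exact: leq_ltn_trans (rank_leq_col _) ltba.
move/rowV0Pn => [w /sub_kermxP wM w0].
have /choice[n /choice[d hnd]] := fun i => fraction_quotient (w 0 i).
have dn0 i : d i != 0 by case: (hnd i).
pose v : 'rV[D]_a := \row_i (n i * \prod_(j | j != i) d j).
have prodE i : \prod_j d j = d i * \prod_(j | j != i) d j by rewrite (bigD1 i).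
have vE : map_mx (@tofrac D) v = tofrac (\prod_j d j) *: w.
  apply/rowP=> i; rewrite !mxE (prodE i) !rmorphM /= -(hnd i).2.
  by rewrite -!mulrA; congr (_ * _); rewrite mulrC.
have d0 : tofrac (\prod_j d j) != 0.
  by rewrite tofrac_eq0; apply/prodf_neq0.
exists v.
  apply: contraNneq w0 => v0; move: vE; rewrite v0 map_mx0 => /esym/eqP.
  by rewrite scaler_eq0 (negPf d0).
apply/eqP; have : map_mx (@tofrac D) (v *m M) == 0.
  by rewrite map_mxM vE -scalemxAl wM scaler0.
move/eqP/matrixP=> h; apply/eqP/matrixP=> i j; apply/eqP.
by have := h i j; rewrite !mxE => /eqP; rewrite tofrac_eq0.
Qed.

Lemma underdetermined_system_fin (D : idomainType) (I J : finType)
    (M : I -> J -> D) : (#|J| < #|I|)%N ->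
  exists2 v : I -> D, (exists i, v i != 0) & forall j, \sum_i v i * M i j = 0.
Proof.
move=> ltJI; pose A := \matrix_(i < #|I|, j < #|J|) M (enum_val i) (enum_val j).
have [v /rV0Pn[i vi0] vA] := underdetermined_system A ltJI.
exists (fun i => v 0 (enum_rank i)).
  by exists (enum_val i); rewrite enum_valK.
move=> j; have := congr1 (fun B : 'rV_#|J| => B 0 (enum_rank j)) vA.
rewrite !mxE => vAj; rewrite -[RHS]vAj.
rewrite (reindex (@enum_val I I)) /=; last exact/onW_bij/enum_val_bij.
by apply: eq_bigr => i' _; rewrite mxE enum_valK enum_rankK.
Qed.

Lemma sum_pth_power (R : comNzRingType) (p : nat) (I : finType) (F : I -> R) :
  p \in [pchar R] -> (\sum_i F i) ^+ p = \sum_i F i ^+ p.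
Proof.
move=> charp; rewrite -(pFrobenius_autE charp) rmorph_sum.
by apply: eq_bigr => i _; rewrite /= pFrobenius_autE.
Qed.

(** * The degree of a function field over its subfield of p-th powers *)

Section FunctionField.
Variables (k0 k : fieldType) (iota : {rmorphism k0 -> k}).
Variables (p : nat) (charp : p \in [pchar k0]).
Hypothesis k0_perfect : perfect_field k0.
Hypothesis kff : function_field iota.

Let p_gt0 : (0 < p)%N. Proof. exact: prime_gt0 (pcharf_prime charp). Qed.

Let charpk : p \in [pchar k]. Proof. by rewrite (fmorph_pchar iota). Qed.

Lemma poly_pth_decomposition (q : {poly k0}) :
  exists m : 'I_p -> {poly k0}, q = \sum_(s < p) m s ^+ p * 'X^s.
Proof.
have charpoly : p \in [pchar {poly k0}] by rewrite pchar_poly.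
have [g gP] := choice (perfect_pth_root charp k0_perfect).
pose Q q := exists m : 'I_p -> {poly k0}, q = \sum_(s < p) m s ^+ p * 'X^s.
rewrite -[q]coefK poly_def; apply: (big_ind Q).
- exists (fun=> 0); rewrite big1 // => s _.
  by rewrite expr0n gtn_eqF // mul0r.
- move=> _ _ [m1 ->] [m2 ->]; exists (fun s => m1 s + m2 s).
  rewrite -big_split; apply: eq_bigr => s _ /=.
  by rewrite -!(pFrobenius_autE charpoly) rmorphD mulrDl.
move=> i _; pose s0 := Ordinal (ltn_pmod i p_gt0).
exists (fun s => if s == s0 then (g q`_i)%:P * 'X^(i %/ p) else 0).
rewrite (bigD1 s0) //= eqxx [X in _ + X]big1 ?addr0; last first.
  by move=> s /negPf->; rewrite expr0n gtn_eqF // mul0r.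
rewrite exprMn -polyC_exp gP -exprM -mulrA -exprD -divn_eq.
by rewrite mul_polyC.
Qed.

(** A spanning family of least size over [k0(x)] is free.  Denominators are
    cleared throughout, so that only polynomials in [x] occur. *)
Lemma function_field_basis : exists (x : k) (d : nat) (b : 'I_d -> k),
  [/\ forall r : {poly k0}, r != 0 -> (map_poly iota r).[x] != 0,
      forall z : k, exists (r : {poly k0}) (q : 'I_d -> {poly k0}), r != 0 /\
        (map_poly iota r).[x] * z = \sum_j (map_poly iota (q j)).[x] * b j
    & forall q : 'I_d -> {poly k0},
        \sum_j (map_poly iota (q j)).[x] * b j = 0 -> forall j, q j = 0].
Proof.
have [[x [xtr [d0 [b0 span0]]]] _] := kff; exists x.
have ev0 (r : {poly k0}) : r != 0 -> (map_poly iota r).[x] != 0.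
  by move=> r0; apply/negP => rx; apply: xtr; exists r.
pose spans d (b : 'I_d -> k) := forall z : k,
  exists (r : {poly k0}) (q : 'I_d -> {poly k0}), r != 0 /\
    (map_poly iota r).[x] * z = \sum_j (map_poly iota (q j)).[x] * b j.
have ex_spans : exists d, `[< exists b : 'I_d -> k, spans d b >].
  exists d0; apply/asboolP; exists b0 => z.
  have [c [cP ->]] := span0 z.
  have /choice[q /choice[r qr]] := cP.
  have r0 i : r i != 0.
    by apply/eqP => ri; have [+ _] := qr i; rewrite ri rmorph0 horner0 eqxx.
  exists (\prod_i r i), (fun j => q j * \prod_(i | i != j) r i); split.
    by apply/prodf_neq0.
  rewrite mulr_sumr; apply: eq_bigr => j _.
  rewrite (bigD1 j) //= !rmorphM /= !hornerM.
  have [rj ->] := qr j.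
  by field; exact: ev0.
case: (ex_minnP ex_spans) => d /asboolP[b bspan] dmin; exists d, b.
split=> // q qb j0; apply/eqP; apply: contraT => qj0.
move: d b bspan dmin q qb j0 qj0.
case=> [|d] b bspan dmin q qb j0 qj0; first by have := ltn_ord j0.
suff : (d.+1 <= d)%N by rewrite ltnn.
apply: dmin; apply/asboolP; exists (fun j => b (lift j0 j)) => z.
have [r [qz [r0 rz]]] := bspan z.
(* eliminate [b j0] from the expression of [z] by means of the relation [qb] *)
exists (q j0 * r), (fun j => q j0 * qz (lift j0 j) - qz j0 * q (lift j0 j)).
split; first by rewrite mulf_neq0.
rewrite rmorphM hornerM -mulrA rz.
have := congr1 (fun t => (map_poly iota (q j0)).[x] * \sum_j (map_poly iota (qz j)).[x] * b j
   - (map_poly iota (qz j0)).[x] * t) qb.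
rewrite mulr0 subr0 => <-.
rewrite !(bigD1_ord j0) //= !mulrDr opprD addrACA mulrCA !mulrA.
rewrite subrr add0r.
rewrite !mulr_sumr -sumrB; apply: eq_bigr => j _.
by rewrite rmorphB !rmorphM /= hornerD hornerN !hornerM mulrBl !mulrA.
Qed.

(** In other words, [k] has degree at most [p] over its subfield of p-th powers.
    Let [b] be a basis of [k] over [k0(x)], of size [d], and look for the
    [alpha i] in the span of [b] over [k0[x]].  The relation splits into one
    equation for each [x^s * b l] with [s < p]; since the [x^s] span [k0[x]] over
    its subring of p-th powers, each equation says that a p-th power vanishes,
    and taking roots makes it linear.  There are [p d] equations for [(p + 1) d]
    unknowns. *)
Lemma dependent_over_pth_powers (w : 'I_p.+1 -> k) :
  exists2 alpha : 'I_p.+1 -> k, (exists i, alpha i != 0) &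
    \sum_i alpha i ^+ p * w i = 0.
Proof.
have [x [d [b [ev0 bspan bfree]]]] := function_field_basis.
pose ev (q : {poly k0}) := (map_poly iota q).[x].
have d_gt0 : (0 < d)%N.
  case: d b bspan bfree => [b bspan bfree|//].
  have [r [q [r0]]] := bspan 1; rewrite big_ord0 mulr1 => /eqP.
  by rewrite (negPf (ev0 _ r0)).
have /choice[r /choice[q rq]] := fun ij : 'I_p.+1 * 'I_d => bspan (b ij.2 ^+ p * w ij.1).
have /choice[m mP] := fun t : ('I_p.+1 * 'I_d) * 'I_d =>
  poly_pth_decomposition (r t.1 ^+ p.-1 * q t.1 t.2).
pose M (ij : 'I_p.+1 * 'I_d) (ls : 'I_d * 'I_p) := m (ij, ls.1) ls.2.
have [|c [[i0 j0] c0] cM] := @underdetermined_system_fin _ _ _ M.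
  by rewrite !card_prod !card_ord mulSn mulnC; lia.
exists (fun i => \sum_j ev (c (i, j) * r (i, j)) * b j).
  exists i0; apply: contraNneq c0 => /bfree/(_ j0)/eqP.
  by rewrite mulf_eq0 (negPf (rq _).1) orbF.
have term i j : (ev (c (i, j) * r (i, j)) * b j) ^+ p * w i =
    \sum_(ls : 'I_d * 'I_p) ev (c (i, j) * M (i, j) ls) ^+ p * (x ^+ ls.2 * b ls.1).
  have -> : (ev (c (i, j) * r (i, j)) * b j) ^+ p * w i =
     ev (c (i, j)) ^+ p * (ev (r (i, j)) ^+ p.-1 * (ev (r (i, j)) * (b j ^+ p * w i))).
    rewrite [ev (_ * _)]/ev rmorphM hornerM -/(ev _) -/(ev _) !exprMn.
    have -> : ev (r (i, j)) ^+ p = ev (r (i, j)) ^+ p.-1 * ev (r (i, j)).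
      by rewrite -exprSr prednK.
    by rewrite !mulrA.
  rewrite [ev (r _) * (_ * _)](rq (i, j)).2 mulr_sumr.
  rewrite -(pair_bigA _ (fun l s =>
    ev (c (i, j) * M (i, j) (l, s)) ^+ p * (x ^+ s * b l))) /=.
  rewrite mulr_sumr; apply: eq_bigr => l _.
  have -> : ev (r (i, j)) ^+ p.-1 * ((map_poly iota (q (i, j) l)).[x] * b l) =
      ev (r (i, j) ^+ p.-1 * q (i, j) l) * b l.
    by rewrite /ev rmorphM rmorphXn /= hornerM horner_exp mulrA.
  rewrite (mP (i, j, l)) /ev rmorph_sum /= horner_sum mulr_suml mulr_sumr.
  apply: eq_bigr => s _.
  by rewrite !rmorphM rmorphXn /= map_polyXn !hornerE !exprMn /M /=; ring.
transitivity (\sum_i \sum_j \sum_(ls : 'I_d * 'I_p)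
    ev (c (i, j) * M (i, j) ls) ^+ p * (x ^+ ls.2 * b ls.1)).
  apply: eq_bigr => i _; rewrite sum_pth_power // mulr_suml.
  by apply: eq_bigr => j _; rewrite term.
rewrite pair_bigA /= exchange_big big1 // => ls _ /=.
rewrite -mulr_suml -sum_pth_power //.
rewrite [X in X ^+ p](_ : _ = ev (\sum_ij c ij * M ij ls)); last first.
  by rewrite /ev rmorph_sum /= horner_sum; apply: eq_bigr => -[].
by rewrite cM /ev rmorph0 horner0 expr0n gtn_eqF // mul0r.
Qed.

End FunctionField.

(** * Approximation by powers with exponent a power of p *)

Section PthPowerApproximation.
Variables (k0 k : fieldType) (iota : {rmorphism k0 -> k}).
Variables (p : nat) (charp : p \in [pchar k0]).
Hypothesis k0_perfect : perfect_field k0.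
Hypothesis kff : function_field iota.
Variable P : place iota.

Let p_gt0 : (0 < p)%N. Proof. exact: prime_gt0 (pcharf_prime charp). Qed.

Let charpk : p \in [pchar k]. Proof. by rewrite (fmorph_pchar iota). Qed.

Let t := uniformizer P.

Lemma ord_pth_power_term (c : k) (i : nat) : c != 0 ->
  c ^+ p * t ^+ i != 0 /\ ord P (c ^+ p * t ^+ i) = p%:Z * ord P c + i%:Z.
Proof.
move=> c0; have t0 : t != 0 := uniformizer_neq0 P.
rewrite mulf_neq0 ?expf_neq0 // ordM ?expf_neq0 // !ordX // ord_uniformizer.
by split=> //; rewrite -mulr_natl !natz.
Qed.

(** The terms have valuations in different classes modulo [p], so no
    cancellation can occur. *)
Lemma ord_pth_power_sum (alpha : nat -> k) (m : nat) : (m <= p)%N ->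
  (forall i, (i < m)%N -> alpha i = 0) \/
  let S := \sum_(i < m) alpha i ^+ p * t ^+ i in
  S != 0 /\ exists i, [/\ (i < m)%N, alpha i != 0
                       & ord P S = p%:Z * ord P (alpha i) + i%:Z].
Proof.
elim: m => [|m IH] ltmp; first by left.
case: (eqVneq (alpha m) 0) => [am0|am0].
  rewrite /= big_ord_recr /= am0 expr0n gtn_eqF // mul0r addr0.
  case: (IH (ltnW ltmp)) => [z|[S0 [i [im ai oS]]]].
    by left=> i; rewrite ltnS leq_eqVlt => /orP[/eqP->|/z].
  by right; split=> //; exists i; rewrite ltnS ltnW.
right; rewrite /= big_ord_recr /=.
have [T0 oT] := ord_pth_power_term m am0.
case: (IH (ltnW ltmp)) => [z|[S0 [i [im ai oS]]]].
  rewrite big1 ?add0r => [|i _]; last by rewrite z // expr0n gtn_eqF // mul0r.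
  by split=> //; exists m; rewrite ltnSn.
set S := \sum_(i < m) _ in S0 oS *; set T := _ * _ in T0 oT *.
have [lt|lt|eqo] := ltgtP (ord P S) (ord P T).
- have [ST oST] := ordD_lt S0 T0 lt; split=> //.
  by exists i; rewrite oST ltnS ltnW.
- have [ST oST] := ordD_lt T0 S0 lt; rewrite addrC; split=> //.
  by exists m; rewrite oST ltnSn.
move: eqo; rewrite oS oT => eqo; exfalso.
have [h|h] := leP (ord P (alpha i)) (ord P (alpha m)); nia.
Qed.

(** The powers [t^i] with [i < p] are independent over the p-th powers by the
    previous lemma, hence a basis, as the degree is at most [p]. *)
Lemma pth_power_expansion (z : k) : exists alpha : nat -> k,
  z = \sum_(i < p) alpha i ^+ p * t ^+ i.
Proof.
pose w (i : 'I_p.+1) := if (i < p)%N then t ^+ i else z.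
have [a [i0 ai0]] := dependent_over_pth_powers charp k0_perfect kff w.
rewrite big_ord_recr /= /w ltnn; under eq_bigr => i _ do rewrite /= ltn_ord.
pose b := a ord_max => rel.
have b0 : b != 0.
  apply: contraTneq ai0 => b0; rewrite negbK; apply/eqP.
  pose a' i := a (inord i).
  have := @ord_pth_power_sum a' p (leqnn p).
  have -> : \sum_(i < p) a' i ^+ p * t ^+ i = 0.
    rewrite -[RHS]rel -/b b0 expr0n gtn_eqF // mul0r addr0.
    apply: eq_bigr => i _; rewrite /a'; congr (a _ ^+ _ * _).
    by apply: val_inj; rewrite /= inordK // ltnS ltnW.
  case=> [z0|[]]; last by rewrite eqxx.
  have : (i0 <= p)%N by rewrite -ltnS.
  rewrite leq_eqVlt => /orP[/eqP i0p|/z0]; last by rewrite /a' inord_val.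
  by rewrite (_ : i0 = ord_max) //; apply: val_inj.
exists (fun i => - a (inord i) / b).
have bp0 : b ^+ p != 0 by rewrite expf_neq0.
move/eqP: rel; rewrite addr_eq0 => /eqP rel.
apply: (mulIf bp0); rewrite [LHS]mulrC -[LHS]opprK -rel mulr_suml -sumrN.
apply: eq_bigr => i _; rewrite exprMn exprVn.
rewrite (_ : inord i = widen_ord (leqnSn p) i); last first.
  by apply: val_inj; rewrite /= inordK // ltnS ltnW.
by rewrite -[(- _) ^+ p](pFrobenius_autE charpk) rmorphN /= pFrobenius_autE; field.
Qed.

(** In the expansion of [z] over p-th powers, the terms with
    [0 < i] have valuation prime to [p], so the one with [i = 0] is dominant
    when [p] divides the valuation of [z]. *)
Lemma pth_power_approximation (z : k) (s : int) : z != 0 -> ord P z = p%:Z * s ->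
  exists2 c : k, c != 0 & (P z < P (z - c ^+ p)%R)%E.
Proof.
move=> z0 oz; have [a zE] := pth_power_expansion z.
(* the expansion of [z] without its term of index 0 *)
pose b i := if i == 0%N then 0 else a i.
have WE : z - a 0%N ^+ p = \sum_(i < p) b i ^+ p * t ^+ i.
  rewrite zE; case: (p) p_gt0 => // p' _; rewrite !big_ord_recl /b /= expr0 mulr1.
  by rewrite expr0n mul0r add0r addrAC subrr add0r.
have lt_zW : (P z < P (z - a 0%N ^+ p)%R)%E.
  rewrite WE; have [b0|[W0 [i [ip bi oW]]]] := @ord_pth_power_sum b p (leqnn p).
    rewrite big1 ?place_lt0 // => i _.
    by rewrite b0 // expr0n gtn_eqF // mul0r.
  rewrite place_lt // oW oz; rewrite -{}WE in W0 oW.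
  have i0 : (0 < i)%N by rewrite lt0n; apply: contraNneq bi => ->; rewrite /b.
  have [//|lt|eqo] := ltgtP (p%:Z * s); last first.
    by exfalso; have [h|h] := leP s (ord P (b i)); nia.
  exfalso; rewrite -oz -oW in lt.
  have Nz0 : - z != 0 by rewrite oppr_eq0.
  have ltN : ord P (z - a 0%N ^+ p) < ord P (- z) by rewrite ordN.
  have [] := ordD_lt W0 Nz0 ltN.
  rewrite addrAC subrr add0r oppr_eq0 ordN expf_eq0 p_gt0 /= => a0.
  rewrite ordX // oW -mulr_natl !natz => eqo.
  by have [h|h] := leP (ord P (a 0%N)) (ord P (b i)); nia.
exists (a 0%N) => //; apply: contraTneq lt_zW => ->.
by rewrite expr0n gtn_eqF // subr0 ltxx.
Qed.

(** Iterated approximation: if [c^p] approximates [z] and [d^(p^n)]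
    approximates [c], then [d^(p^(n+1))] approximates [z], because the Frobenius
    map multiplies valuations by [p]. *)
Lemma ppow_approximation (n : nat) (z : k) (s : int) :
  z != 0 -> ord P z = (p ^ n)%N%:Z * s ->
  exists2 c : k, c != 0 & (P z < P (z - c ^+ (p ^ n))%R)%E.
Proof.
elim: n z s => [|n IH] z s z0 oz.
  by exists z => //; rewrite expn0 expr1 subrr place_lt0.
have [|c c0 zc] := @pth_power_approximation z ((p ^ n)%N%:Z * s) z0.
  by rewrite oz expnS PoszM mulrA.
have ocp : ord P (c ^+ p) = ord P z.
  have zNc : (P z < P (- (z - c ^+ p))%R)%E by rewrite placeN.
  by have [_] := ordD_place_lt z0 zNc; rewrite opprB addrC subrK.
have oc : ord P c = (p ^ n)%N%:Z * s.
  have pz : p%:Z != 0 by rewrite eqz_nat -lt0n.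
  apply: (mulfI pz); rewrite mulrA -PoszM -expnS -oz -ocp ordX //.
  by rewrite -[RHS]mulr_natl !natz.
have [d d0 cd] := IH c s c0 oc; exists d => //.
have -> : z - d ^+ (p ^ n.+1) = (z - c ^+ p) + (c - d ^+ (p ^ n)) ^+ p.
  rewrite -!(pFrobenius_autE charpk) rmorphB /= !pFrobenius_autE.
  by rewrite -exprM -expnSr addrA subrK.
apply: place_ltD => //.
case: (eqVneq (c - d ^+ (p ^ n)) 0) => [->|e0].
  by rewrite expr0n gtn_eqF // place_lt0.
rewrite place_lt ?expf_neq0 // -ocp !ordX // ltrMn2r p_gt0 /=.
by rewrite -place_lt.
Qed.

End PthPowerApproximation.

(** * Additive polynomials *)

Section AdditivePolynomial.
Variables (k0 : fieldType) (p n : nat) (charp : p \in [pchar k0]).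
Variable a : 'I_n -> k0.
Let f := additive_polynomial p a.

Let p_gt1 : (1 < p)%N. Proof. exact: prime_gt1 (pcharf_prime charp). Qed.

Lemma size_additive_polynomial_tail :
  (size (\sum_(i < n) a i *: 'X^(p ^ i) : {poly k0})%R < size ('X^(p ^ n) : {poly k0}))%N.
Proof.
rewrite size_polyXn ltnS; apply: (leq_trans (size_sum _ _ _)).
apply/bigmax_leqP => i _; apply: (leq_trans (size_scale_leq _ _)).
by rewrite size_polyXn ltn_exp2l.
Qed.

Lemma size_additive_polynomial : size f = (p ^ n).+1.
Proof.
by rewrite size_polyDl ?size_additive_polynomial_tail // size_polyXn.
Qed.

Lemma monic_additive_polynomial : f \is monic.
Proof.
by rewrite monicE lead_coefDl ?size_additive_polynomial_tail // lead_coefXn.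
Qed.

Lemma horner_additive_polynomial (F : fieldType) (j : {rmorphism k0 -> F}) z :
  (map_poly j f).[z] = z ^+ (p ^ n) + \sum_(i < n) j (a i) * z ^+ (p ^ i).
Proof.
rewrite rmorphD /= map_polyXn rmorph_sum /= hornerD hornerXn horner_sum.
congr (_ + _); apply: eq_bigr => i _.
by rewrite linearZ /= map_polyXn hornerZ hornerXn.
Qed.

Lemma exprD_ppow (F : fieldType) (j : {rmorphism k0 -> F}) (x y : F) i :
  (x + y) ^+ (p ^ i) = x ^+ (p ^ i) + y ^+ (p ^ i).
Proof.
apply: exprDn_pchar; rewrite pnatX; apply/orP; left.
by rewrite pnatE ?(fmorph_pchar j) // (pcharf_prime charp).
Qed.

Lemma additive_polynomialD (F : fieldType) (j : {rmorphism k0 -> F}) x y :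
  (map_poly j f).[x + y] = (map_poly j f).[x] + (map_poly j f).[y].
Proof.
rewrite !horner_additive_polynomial (exprD_ppow j) addrACA -big_split /=.
by congr (_ + _); apply: eq_bigr => i _; rewrite (exprD_ppow j) mulrDr.
Qed.

Lemma additive_polynomialB (F : fieldType) (j : {rmorphism k0 -> F}) x y :
  (map_poly j f).[x - y] = (map_poly j f).[x] - (map_poly j f).[y].
Proof. by have := additive_polynomialD j (x - y) y; rewrite subrK => ->; rewrite addrK. Qed.

Lemma deriv_additive_polynomial (hn : (0 < n)%N) : f^`() = (a (Ordinal hn))%:P.
Proof.
have dX i : (0 < i)%N -> ('X^(p ^ i) : {poly k0})^`() = 0.
  move=> i0; rewrite derivXn -mulr_natr -polyC_natr natrX (pcharf0 charp).
  by rewrite expr0n gtn_eqF // polyC0 mulr0.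
rewrite derivD dX // add0r raddf_sum /= (bigD1 (Ordinal hn)) //=.
rewrite expn0 expr1 derivZ derivX alg_polyC big1 ?addr0 // => i i0.
by rewrite derivZ dX ?scaler0 // lt0n; apply: contraNneq i0 => i0; apply/eqP/val_inj.
Qed.

(** At a pole of [z] the pole of [z^(p^i)] grows with [i], and the coefficients
    are constants. *)
Lemma ord_additive_polynomial (F : fieldType) (j : {rmorphism k0 -> F})
    (P : place j) (z : F) : z != 0 -> ord P z < 0 ->
  let w := (map_poly j f).[z] in
  (P (z ^+ (p ^ n))%R < P (w - z ^+ (p ^ n))%R)%E /\
  (w != 0 /\ ord P w = (p ^ n)%N%:Z * ord P z).
Proof.
move=> z0 oz; rewrite /= horner_additive_polynomial.
have dom : (P (z ^+ (p ^ n))%R < P (\sum_(i < n) j (a i) * z ^+ (p ^ i))%R)%E.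
  apply: (big_ind (fun x => P (z ^+ (p ^ n))%R < P x)%E) => [|x y|i _].
  - by rewrite place_lt0 ?expf_neq0.
  - exact: place_ltD.
  have [->|ai0] := eqVneq (a i) 0.
    by rewrite rmorph0 mul0r place_lt0 ?expf_neq0.
  have jai0 : j (a i) != 0 by rewrite fmorph_eq0.
  rewrite place_lt ?mulf_neq0 ?expf_neq0 // ordM ?expf_neq0 // const_ord // add0r.
  by rewrite !ordX // ltr_nMn2l // ltn_exp2l.
split; first by rewrite addrAC subrr add0r.
have [w0 ow] := ordD_place_lt (expf_neq0 (p ^ n) z0) dom.
by split; rewrite // ow ordX // -mulr_natl natz.
Qed.

Lemma uniq_additive_roots (hn : (0 < n)%N) (roots : seq k0) :
  a (Ordinal hn) != 0 -> f = \prod_(r <- roots) ('X - r%:P) ->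
  uniq roots /\ size roots = (p ^ n)%N.
Proof.
move=> a0 fE; split.
  rewrite -separable_prod_XsubC -fE unlock deriv_additive_polynomial.
  by rewrite -alg_polyC coprimepZr // coprimep1.
by have := size_additive_polynomial; rewrite fE size_prod_XsubC => -[].
Qed.

End AdditivePolynomial.

Lemma ppow_factorization (p n s : nat) : prime p -> (0 < s)%N ->
  (exists l m, [/\ coprime l p, (m < n)%N & s = (l * p ^ m)%N]) \/ (p ^ n %| s)%N.
Proof.
move=> p_pr s0; have [l lp sE] := pfactor_coprime p_pr s0.
have [lt|ge] := ltnP (logn p s) n.
  by left; exists l, (logn p s); rewrite coprime_sym.
by right; rewrite sE dvdn_mull // dvdn_exp2l.
Qed.

Section Generator.
Variables (k0 k : fieldType) (iota : {rmorphism k0 -> k}).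
Variables (p n : nat) (charp : p \in [pchar k0]) (hn : (0 < n)%N).
Hypothesis k0_perfect : perfect_field k0.
Hypothesis kff : function_field iota.
Variables (P : place iota) (a : 'I_n -> k0).
Let f := additive_polynomial p a.

(** As long as the pole order of [u] is a multiple of [p^n], subtracting [f(z)]
    for an approximate [p^n]-th root [z] of [u] lowers it. *)
Lemma reduce_pole (u : k) : exists z : k,
  let u' := u - (map_poly iota f).[z] in
  (0 <= P u')%E \/ exists l m : nat, [/\ coprime l p, (m < n)%N &
        P u' = (- (l * p ^ m)%N%:Z)%:E].
Proof.
have p_pr := pcharf_prime charp; have p_gt1 := prime_gt1 p_pr.
have f0 : (map_poly iota f).[0] = 0.
  by have := additive_polynomialB charp a iota 0 0; rewrite !subrr.
have [N] := ubnP `|ord P u|%N; elim: N u => // N IH u ltN.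
have [u0|u0] := eqVneq u 0.
  by exists 0; left; rewrite f0 u0 subr0 valuation0 leey.
have [ou|ou] := leP 0 (ord P u).
  by exists 0; left; rewrite f0 subr0 place_ge0.
pose s := `|ord P u|%N; have ouE : ord P u = - s%:Z by rewrite /s; lia.
have s0 : (0 < s)%N by lia.
have [[l [m [lp mn sE]]]|/dvdnP[q sE]] := ppow_factorization n p_pr s0.
  by exists 0; right; exists l, m; rewrite f0 subr0 placeE // ouE sE.
have ouq : ord P u = (p ^ n)%N%:Z * - q%:Z by rewrite ouE sE PoszM; lia.
have [c c0 uc] := ppow_approximation charp k0_perfect kff u0 ouq.
have lt_uNc : (P u < P (- (u - c ^+ (p ^ n)))%R)%E by rewrite placeN.
have [_] := ordD_place_lt u0 lt_uNc; rewrite opprB addrC subrK => oc.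
have oc0 : ord P c < 0.
  by move: oc; rewrite ordX // => oc; rewrite -oc pmulrn_llt0 ?expn_gt0 ?(ltnW p_gt1) in ou.
have [dom _] := ord_additive_polynomial charp a c0 oc0.
have lt_u : (P u < P (u - (map_poly iota f).[c])%R)%E.
  have -> : u - (map_poly iota f).[c] =
      (u - c ^+ (p ^ n)) - ((map_poly iota f).[c] - c ^+ (p ^ n)) by ring.
  apply: place_ltD => //; rewrite placeN; apply: le_lt_trans dom.
  by rewrite !placeE ?expf_neq0 // oc.
have [w0|w0] := eqVneq (u - (map_poly iota f).[c]) 0.
  by exists c; left; rewrite w0 valuation0 leey.
have [ow|ow] := leP 0 (ord P (u - (map_poly iota f).[c])).
  by exists c; left; rewrite place_ge0.
have ltN' : (`|ord P (u - (map_poly iota f).[c])|%N < N)%N.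
  by move: lt_u; rewrite place_lt //; lia.
have [z Hz] := IH _ ltN'.
exists (c + z); move: Hz; rewrite /= additive_polynomialD //.
by rewrite opprD addrA.
Qed.

End Generator.

(** * Places of an extension field *)

Section LiesOver.
Variables (k0 k : fieldType) (iota : {rmorphism k0 -> k}) (K : fieldExtType k).
Variables (P : place iota) (Q : place_above iota K).
Hypothesis QP : lies_over Q P.

Lemma in_alg_eq0 (x : k) : (x%:A == 0 :> K) = (x == 0).
Proof. exact: (fmorph_eq0 (in_alg K)). Qed.

Lemma in_algV (x : k) : (x^-1)%:A = (x%:A)^-1 :> K.
Proof. exact: (fmorphV (in_alg K)). Qed.

Lemma in_algM (x y : k) : (x * y)%:A = x%:A * y%:A :> K.
Proof. exact: (rmorphM (in_alg K)). Qed.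

Lemma in_algX (x : k) n : (x ^+ n)%:A = x%:A ^+ n :> K.
Proof. exact: (rmorphXn (in_alg K)). Qed.

Lemma lies_over_videal x : (x%:A \in videal Q) = (x \in videal P).
Proof. exact: QP. Qed.

Lemma ord_lies_over_unit x : x != 0 -> ord P x = 0 -> ord Q x%:A = 0.
Proof.
move=> x0 ox; have xA0 : x%:A != 0 :> K by rewrite in_alg_eq0.
have := lies_over_videal x; have := lies_over_videal x^-1.
rewrite in_algV !videalE ?invr_eq0 // !ordV // ox oppr0 ltxx.
by rewrite oppr_gt0 => h1 h2; have [] := ltgtP (ord Q x%:A) 0; rewrite ?h1 ?h2.
Qed.

Let e := ramification_index Q P.

Lemma ramification_indexE : ord Q (uniformizer P)%:A = e%:Z.
Proof.
have := lies_over_videal (uniformizer P).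
rewrite uniformizer_videal videalE ?in_alg_eq0 ?uniformizer_neq0 //.
by move=> h; rewrite /e /ramification_index gtz0_abs.
Qed.

Lemma ramification_index_gt0 : (0 < e)%N.
Proof.
have := lies_over_videal (uniformizer P).
rewrite uniformizer_videal videalE ?in_alg_eq0 ?uniformizer_neq0 //.
by rewrite ramification_indexE; lia.
Qed.

Lemma ord_lies_over x : x != 0 -> ord Q x%:A = e%:Z * ord P x.
Proof.
have t0 := uniformizer_neq0 P.
have pos z : z != 0 -> 0 <= ord P z -> ord Q z%:A = e%:Z * ord P z.
  move=> z0 oz; pose s := `|ord P z|%N; have ozE : ord P z = s%:Z by lia.
  pose w := z / uniformizer P ^+ s.
  have w0 : w != 0 by rewrite mulf_neq0 ?invr_eq0 ?expf_neq0.
  have zE : z = w * uniformizer P ^+ s by rewrite divfK ?expf_neq0.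
  clearbody w.
  have ow : ord P w = 0.
    move: ozE; rewrite {1}zE ordM ?expf_neq0 // ordX // ord_uniformizer.
    by rewrite natz -[RHS]add0r => /addIr.
  have := ord_lies_over_unit w0 ow.
  rewrite ozE zE in_algM in_algX.
  rewrite ordM ?expf_neq0 ?in_alg_eq0 // => ->; rewrite add0r ordX ?in_alg_eq0 //.
  by rewrite ramification_indexE -mulr_natr natz.
move=> x0; have [/pos->//|ox] := leP 0 (ord P x).
have := pos x^-1; rewrite invr_eq0 in_algV !ordV ?in_alg_eq0 //.
move=> /(_ x0); rewrite oppr_ge0 (ltW ox) => /(_ isT); rewrite mulrN.
by move/(congr1 -%R); rewrite !opprK.
Qed.

Lemma lies_over_vring x : x \in vring P -> x%:A \in vring Q.
Proof.
have [->|x0] := eqVneq x 0; first by rewrite scale0r !vring0.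
by rewrite !vringE ?in_alg_eq0 // ord_lies_over // => ox; rewrite mulr_ge0.
Qed.

Lemma horner_vring (G : {poly k}) z : G \is a polyOver (vring P) ->
  z \in vring Q -> (map_poly (in_alg K) G).[z] \in vring Q.
Proof.
move=> /polyOverP hG hz; apply: rpred_horner => //.
by apply/polyOverP => i; rewrite coef_map; apply: lies_over_vring.
Qed.

Lemma horner_videal (G : {poly k}) z : G \is a polyOver (videal P) ->
  z \in vring Q -> (map_poly (in_alg K) G).[z] \in videal Q.
Proof.
move=> /polyOverP hG hz; rewrite horner_coef rpred_sum // => i _.
by rewrite coef_map videalMr ?rpredX //= lies_over_videal.
Qed.

End LiesOver.

Lemma size_sub_lead (R : nzRingType) (G : {poly R}) :
  (size (G - lead_coef G *: 'X^((size G).-1))%R <= (size G).-1)%N.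
Proof.
apply/leq_sizeP => i; rewrite coefB coefZ coefXn leq_eqVlt => /orP[/eqP<-|lt_i].
  by rewrite eqxx mulr1 subrr.
by rewrite gtn_eqF // mulr0 subr0 nth_default // (leq_trans (leqSpred _)).
Qed.

Lemma monic_division (R : nzRingType) (S : subringClosed R) (H G : {poly R}) :
  H \is monic -> H \is a polyOver S -> G \is a polyOver S ->
  exists A B : {poly R}, [/\ A \is a polyOver S, B \is a polyOver S,
    (size B < size H)%N & G = A * H + B].
Proof.
move=> Hm HS; have [N] := ubnP (size G); elim: N G => // N IH G ltN GS.
have H0 : (0 < size H)%N by rewrite size_poly_gt0 monic_neq0.
have [lt|ge] := ltnP (size G) (size H).
  by exists 0, G; rewrite rpred0 mul0r add0r.
have G0 : (0 < size G)%N by apply: leq_trans ge.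
pose c := lead_coef G; pose d := (size G - size H)%N.
have cS : c \in S by move/polyOverP: GS; apply.
pose M := c%:P * 'X^d.
have MS : M \is a polyOver S by rewrite rpredM ?polyOverC ?rpredX ?polyOverX.
have Hl : H`_(size H).-1 = 1 by have /monicP := Hm.
have szGM : (size (G - M * H)%R <= (size G).-1)%N.
  apply/leq_sizeP => i le_i; rewrite coefB -mulrA coefCM -commr_polyXn coefMXn.
  have [lt_id|ge_id] := ltnP i d; first by rewrite mulr0 subr0 nth_default //; lia.
  move: le_i; rewrite leq_eqVlt => /orP[/eqP<-|lt_i].
    rewrite (_ : ((size G).-1 - d = (size H).-1)%N); last by rewrite /d; lia.
    by rewrite Hl mulr1 subrr.
  rewrite [G`_i]nth_default; last exact: leq_trans (leqSpred _) lt_i.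
  rewrite [H`_ _]nth_default ?mulr0 ?subr0 //.
  by move: lt_i ge H0; rewrite /d; move: (size H) (size G) => sH sG; lia.
have [||A [B [AS BS szB GE]]] := IH (G - M * H).
- by apply: leq_ltn_trans szGM _; lia.
- by apply: rpredB => //; apply: rpredM.
exists (M + A), B; split=> //; first by rewrite rpredD.
by rewrite mulrDl -addrA -GE addrC subrK.
Qed.

(** Newton interpolation: when the nodes are integral and distinct modulo the
    ideal, the divided differences of small values have unit denominators and
    stay small. *)
Lemma small_values_small_coefficients (k0 F : fieldType) (j : k0 -> F)
    (Q : place j) (zs : seq F) (C : {poly F}) :
  {subset zs <= vring Q} ->
  pairwise (fun z z' => z - z' \notin videal Q) zs ->
  (size C <= size zs)%N -> {in zs, forall z, C.[z] \in videal Q} ->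
  C \is a polyOver (videal Q).
Proof.
elim: zs C => [|z zs IH] C zsv zsd szC Cz.
  by move: szC; rewrite leqn0 size_poly_eq0 => /eqP->; rewrite rpred0.
have zv : z \in vring Q by apply: zsv; rewrite mem_head.
have zsv' : {subset zs <= vring Q} by move=> x xz; apply: zsv; rewrite inE xz orbT.
move: zsd; rewrite /= => /andP[/allP zd zsd].
have cz : C.[z] \in videal Q by apply: Cz; rewrite mem_head.
have /factor_theorem[C1 CE] : root (C - C.[z]%:P) z.
  by rewrite rootE !hornerE subrr.
have C1P : C1 \is a polyOver (videal Q).
  apply: IH => // [|x xz].
    have [->|C10] := eqVneq C1 0; first by rewrite size_poly0.
    have : size (C - C.[z]%:P) = (size C1).+1.
      by rewrite CE size_Mmonic ?monicXsubC // size_XsubC addn2.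
    have := size_polyD C (- C.[z]%:P); rewrite size_polyN size_polyC => le_C szCz.
    move: le_C; rewrite szCz leq_max => /orP[le_C|].
      by rewrite -ltnS; apply: leq_trans le_C szC.
    have C1_gt0 : (0 < size C1)%N by rewrite size_poly_gt0.
    by case: (_ != 0) => //=; rewrite ltnS leqNgt C1_gt0.
  have xv := zsv' _ xz; have xd := zd _ xz.
  have xzv : z - x \in vring Q by rewrite rpredB.
  have zx0 : z - x != 0 by apply: contraNneq xd => ->; rewrite rpred0.
  have -> : C1.[x] = (C.[z] - C.[x]) * (z - x)^-1.
    have := congr1 (fun D => D.[x]) CE; rewrite !hornerE => h.
    by apply: (mulIf zx0); rewrite divfK //; rewrite -opprB -[RHS]opprB h; ring.
  rewrite videalMr ?vringV // rpredB //.
  by apply: Cz; rewrite inE xz orbT.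
have -> : C = C1 * ('X - z%:P) + C.[z]%:P by rewrite -CE subrK.
apply/polyOverP => i; rewrite coefD mulrBr coefB coefMX coefMC coefC.
move/polyOverP: C1P => C1P.
apply: rpredD; last by case: ifP => _; rewrite ?rpred0.
apply: rpredB; first by case: ifP => _; rewrite ?rpred0.
by rewrite videalMr.
Qed.

(** * Unramified places *)

Section SeparableReduction.
Variables (k0 k : fieldType) (iota : {rmorphism k0 -> k}) (K : fieldExtType k).
Variables (P : place iota) (Q : place_above iota K).
Hypothesis QP : lies_over Q P.

Let ev (G : {poly k}) (z : K) := (map_poly (in_alg K) G).[z].
Let e := ramification_index Q P.

Let evM G H z : ev (G * H) z = ev G z * ev H z.
Proof. by rewrite /ev rmorphM hornerM. Qed.

Let evD G H z : ev (G + H) z = ev G z + ev H z.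
Proof. by rewrite /ev rmorphD hornerD. Qed.

Let evC c z : ev c%:P z = c%:A.
Proof. by rewrite /ev map_polyC hornerC. Qed.

Variable y : K.
Hypothesis y_int : y \in vring Q.

Let ev_int (G : {poly k}) : G \is a polyOver (vring P) -> ev G y \in vring Q.
Proof. by move=> GP; apply: horner_vring. Qed.

(** A monic integral [H] of least degree among those with [H(y)] in the ideal
    is a lift of the minimal polynomial of the residue of [y]. *)
Lemma residual_minimal_polynomial (g : {poly k}) :
  g \is monic -> g \is a polyOver (vring P) -> ev g y \in videal Q ->
  exists H : {poly k}, [/\ H \is monic, H \is a polyOver (vring P),
    ev H y \in videal Q
    & forall R : {poly k}, R \is a polyOver (vring P) ->
        (size R < size H)%N -> ev R y \in videal Q ->
        R \is a polyOver (videal P)].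
Proof.
move=> gm gP gy.
have exH : exists s, `[< exists H : {poly k}, [/\ H \is monic,
    H \is a polyOver (vring P), ev H y \in videal Q & size H = s] >].
  by exists (size g); apply/asboolP; exists g.
case: (ex_minnP exH) => s /asboolP[H [Hm HP Hy Hs]] smin.
exists H; split=> // R; have [N] := ubnP (size R).
elim: N R => // N IH R ltN RP ltR Ry.
have [->|R0] := eqVneq R 0; first by rewrite rpred0.
have cv : lead_coef R \in vring P by move/polyOverP: RP; apply.
have c0 : lead_coef R != 0 by rewrite lead_coef_eq0.
have [ci|cNi] := boolP (lead_coef R \in videal P).
  pose M := lead_coef R *: 'X^((size R).-1).
  have Mi : M \is a polyOver (videal P).
    apply/polyOverP => i; rewrite coefZ coefXn.
    by case: eqP => _; rewrite ?mulr1 ?mulr0 ?rpred0.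
  have MP : M \is a polyOver (vring P).
    by apply/polyOverP => i; apply: videal_sub; move/polyOverP: Mi; apply.
  have szRM : (size (R - M)%R < size R)%N.
    have R1 : (0 < size R)%N by rewrite size_poly_gt0.
    by rewrite -[X in (_ < X)%N]prednK // ltnS size_sub_lead.
  rewrite -(subrK M R) rpredD //; apply: IH.
  - by rewrite -ltnS; apply: leq_trans ltN.
  - by rewrite rpredB.
  - exact: ltn_trans szRM ltR.
  have -> : ev (R - M) y = ev R y - ev M y by rewrite /ev rmorphB !hornerE.
  by rewrite rpredB // (horner_videal QP).
suff : (s <= size R)%N by rewrite -Hs leqNgt ltR.
apply: smin; apply/asboolP; exists ((lead_coef R)^-1 *: R); split.
- by rewrite monicE lead_coefZ mulVf.
- apply/polyOverP => i; rewrite coefZ rpredM //; last by move/polyOverP: RP; apply.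
  by rewrite (vringV cv cNi).
- rewrite -mul_polyC evM evC videalMl // (lies_over_vring QP) //.
  by rewrite (vringV cv cNi).
by rewrite size_scale // invr_eq0.
Qed.

(** The residue of [T] is the reduction of [g] divided by the minimal
    polynomial of the residue of [y]; separability makes [T(y)] a unit.  At
    another root of [g] either [T] is small, or that root has the same minimal
    polynomial modulo the ideal as [y], and then [G] is small there. *)
Lemma residual_cofactor (g : {poly k}) :
  g \is monic -> g \is a polyOver (vring P) -> ev g y = 0 ->
  ev g^`() y \notin videal Q ->
  exists T : {poly k}, [/\ T \is a polyOver (vring P), ev T y \notin videal Q
    & forall G, G \is a polyOver (vring P) -> ev G y \in videal Q ->
      forall z, z \in vring Q -> ev g z = 0 -> ev (G * T) z \in videal Q].
Proof.
move=> gm gP gy dgy.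
have gyi : ev g y \in videal Q by rewrite gy rpred0.
have [H [Hm HP Hy Hmin]] := residual_minimal_polynomial gm gP gyi.
have divH G : G \is a polyOver (vring P) -> ev G y \in videal Q ->
    exists A B : {poly k}, [/\ A \is a polyOver (vring P),
      B \is a polyOver (videal P) & G = A * H + B].
  move=> GP Gy; have [A [B [AP BP szB GE]]] := monic_division Hm HP GP.
  exists A, B; split=> //; apply: Hmin => //.
  have -> : ev B y = ev G y - ev A y * ev H y.
    by rewrite GE evD evM addrC addKr.
  by rewrite rpredB // videalMl // ev_int.
have [T [B [TP Bi gE]]] := divH g gP gyi.
exists T; split=> // [|G GP Gy z zv gz].
  apply: contra dgy => /(divH T TP)[A [B' [AP Bi' TE]]].
  have dB : B^`() \is a polyOver (videal P).
    by apply/polyOverP => i; rewrite coef_deriv rpredMn //; move/polyOverP: Bi; apply.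
  have dP F : F \is a polyOver (vring P) -> F^`() \is a polyOver (vring P).
    by move/polyOverP=> FP; apply/polyOverP => i; rewrite coef_deriv rpredMn.
  have -> : ev g^`() y = ev T^`() y * ev H y + ev T y * ev H^`() y + ev B^`() y.
    by rewrite gE derivD derivM !evD !evM.
  have Ty : ev T y \in videal Q.
    rewrite TE evD evM rpredD //; last exact: (horner_videal QP).
    by rewrite videalMl // ev_int.
  rewrite !rpredD //; last exact: (horner_videal QP).
    by rewrite videalMl // ev_int // dP.
  by rewrite videalMr // ev_int // dP.
have [A [B' [AP Bi' GE]]] := divH G GP Gy.
have : ev T z * ev H z \in videal Q.
  have -> : ev T z * ev H z = - ev B z.
    by apply/eqP; rewrite -addr_eq0 -evM -evD -gE gz.
  by rewrite rpredN (horner_videal QP).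
rewrite videalM ?(horner_vring QP) // evM => /orP[Tz|Hz].
  by rewrite videalMl // (horner_vring QP).
rewrite videalMr ?(horner_vring QP) // GE evD evM rpredD //.
  by rewrite videalMl // (horner_vring QP).
exact: (horner_videal QP).
Qed.

Lemma integral_multiple (G : {poly k}) : exists c : k,
  [/\ c != 0, c \in vring P & c *: G \is a polyOver (vring P)].
Proof.
elim/poly_ind: G => [|G a [c [c0 cP GP]]].
  by exists 1; rewrite oner_neq0 vring1 scaler0 rpred0.
have [b [b0 bP abP]] : exists b, [/\ b != 0, b \in vring P & b * a \in vring P].
  have [aP|aNP] := boolP (a \in vring P).
    by exists 1; rewrite oner_neq0 vring1 mul1r.
  have a0 : a != 0 by apply: contraNneq aNP => ->; rewrite vring0.
  exists a^-1; rewrite invr_eq0 a0 mulVf // vring1; split=> //.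
  by move: aNP; rewrite !vringE ?invr_eq0 // ordV // -ltNge oppr_ge0 => /ltW.
exists (b * c); rewrite mulf_neq0 // rpredM //; split=> //.
rewrite scalerDr scalerAl rpredD //.
  by rewrite rpredM ?polyOverX // -scalerA polyOverZ.
by rewrite -mul_polyC -polyCM polyOverC mulrAC rpredM.
Qed.

(** Induction on the valuation of [G(y)].  When [G(y)] lies in the
    ideal, multiply by the cofactor [T]: all values of [G T] at the roots of [g]
    are small, hence so are the coefficients of its remainder modulo [g];
    dividing these by a uniformizer of [P] lowers the valuation by [e]. *)
Lemma ramification_index_dvd_ord (g : {poly k}) (zs : seq K) :
  g \is monic -> g \is a polyOver (vring P) -> ev g y = 0 ->
  ev g^`() y \notin videal Q ->
  {subset zs <= vring Q} ->
  pairwise (fun z z' => z - z' \notin videal Q) zs ->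
  size g = (size zs).+1 -> {in zs, forall z, ev g z = 0} ->
  forall G : {poly k}, ev G y != 0 -> exists s : int, ord Q (ev G y) = e%:Z * s.
Proof.
move=> gm gP gy dgy zsv zsd szg gz.
have [T [TP Ty TG]] := residual_cofactor gm gP gy dgy.
have [Ty0 oT] := ord_unit (ev_int TP) Ty.
have t0 := uniformizer_neq0 P.
have g0 := monic_neq0 gm.
have int_case (G : {poly k}) : G \is a polyOver (vring P) -> ev G y != 0 ->
    exists s : int, ord Q (ev G y) = e%:Z * s.
  have [N] := ubnP `|ord Q (ev G y)|%N; elim: N G => // N IH G ltN GP Gy0.
  have [Gy|Gy] := boolP (ev G y \in videal Q); last first.
    by have [_ ->] := ord_unit (ev_int GP) Gy; exists 0; rewrite mulr0.
  pose C := (G * T) %% g.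
  have CE z : ev g z = 0 -> ev C z = ev (G * T) z.
    by move=> gz0; rewrite [in RHS](divp_eq (G * T) g) evD evM gz0 mulr0 add0r.
  have Ci : C \is a polyOver (videal P).
    have : map_poly (in_alg K) C \is a polyOver (videal Q).
      apply: (small_values_small_coefficients zsv zsd).
        by rewrite size_map_poly -ltnS -szg ltn_modp.
      by move=> z zz; rewrite [_.[z]]CE ?gz // TG // ?zsv ?gz.
    move/polyOverP=> Ci; apply/polyOverP=> i.
    by have := Ci i; rewrite coef_map /= (lies_over_videal QP).
  pose C1 := (uniformizer P)^-1 *: C.
  have C1P : C1 \is a polyOver (vring P).
    apply/polyOverP => i; rewrite coefZ mulrC videal_divuniformizer //.
    by move/polyOverP: Ci; apply.
  have GT : ev G y * ev T y = (uniformizer P)%:A * ev C1 y.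
    by rewrite -evM -CE // -[in LHS](scalerKV t0 C) -mul_polyC evM evC.
  have C1y0 : ev C1 y != 0.
    by apply: contraTneq (mulf_neq0 Gy0 Ty0) => h; rewrite GT h mulr0 eqxx.
  have oG : ord Q (ev G y) = e%:Z + ord Q (ev C1 y).
    have tA0 : (uniformizer P)%:A != 0 :> K by rewrite in_alg_eq0.
    rewrite -[LHS]addr0 -oT -ordM // GT ordM //.
    by rewrite (ramification_indexE QP).
  have e0 := ramification_index_gt0 QP; rewrite -/e in e0.
  have oC1 : 0 <= ord Q (ev C1 y) by rewrite -vringE // ev_int.
  have ltN' : (`|ord Q (ev C1 y)| < N)%N.
    move: ltN e0 oC1; rewrite oG; move: (ord Q (ev C1 y)) e => o d; clear; lia.
  have [s oC1E] := IH C1 ltN' C1P C1y0.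
  by exists (1 + s); rewrite oG oC1E mulrDr mulr1.
move=> G Gy0; have [c [c0 cP cGP]] := integral_multiple G.
have cG : ev (c *: G) y = c%:A * ev G y by rewrite -mul_polyC evM evC.
have cA0 : c%:A != 0 :> K by rewrite in_alg_eq0.
have [|s] := int_case _ cGP; first by rewrite cG mulf_neq0.
rewrite cG ordM // (ord_lies_over QP) // => os.
by exists (s - ord P c); rewrite mulrBr -os -/e addrC addKr.
Qed.

End SeparableReduction.

(** * Existence of a place above a given place *)

Section SubringOfSet.
Variables (R : nzRingType) (B : {pred R}) (B_subring : subring_closed B).
(** An alias on which the closure proof can be registered. *)
Definition subring_of : {pred R} := B.
HB.instance Definition _ := GRing.isSubringClosed.Build R subring_of B_subring.
Definition subringClosed_of : subringClosed R := subring_of.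
End SubringOfSet.

Section ChevalleyExtension.
Variables (k0 k : fieldType) (iota : {rmorphism k0 -> k}) (K : fieldExtType k).
Variable P : place iota.
Let t : K := (uniformizer P)%:A.

Let t0 : t != 0. Proof. by rewrite in_alg_eq0 uniformizer_neq0. Qed.

(** The subrings of [K] over the valuation ring of [P] in which its maximal
    ideal does not generate the unit ideal. *)
Definition proper_overring (B : {pred K}) :=
  [/\ subring_closed B, forall c, c \in vring P -> c%:A \in B & t^-1 \notin B].

Let tV_constant (c : k) : c \in vring P -> t^-1 <> c%:A.
Proof.
have u0 := uniformizer_neq0 P; rewrite -in_algV => + /(fmorph_inj (in_alg K)) cE.
by rewrite -cE vringE ?invr_eq0 // ordV // ord_uniformizer.
Qed.

Lemma constants_proper_overring :
  proper_overring (fun x : K => `[< exists2 c, c \in vring P & x = c%:A >]).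
Proof.
split=> [|c cP|]; last first.
- by apply/asboolP => -[c cP]; apply: tV_constant.
- by apply/asboolP; exists c.
split.
- by apply/asboolP; exists 1; rewrite ?vring1 ?scale1r.
- move=> _ _ /asboolP[c cP ->] /asboolP[d dP ->]; apply/asboolP.
  by exists (c - d); rewrite ?rpredB // scalerBl.
- move=> _ _ /asboolP[c cP ->] /asboolP[d dP ->]; apply/asboolP.
  by exists (c * d); rewrite ?rpredM // in_algM.
Qed.

Lemma union_proper_overring (F : set (set K)) :
  (forall X, F X -> X = set0 \/ proper_overring (fun x => `[< X x >])) ->
  total_on F subset -> (exists2 X, F X & X <> set0) ->
  proper_overring (fun x => `[< (\bigcup_(X in F) X)%classic x >]).
Proof.
move=> Fgood Ftot [X0 X0F X00].
have Fprop X x : F X -> X x -> proper_overring (fun x => `[< X x >]).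
  by move=> /Fgood[->|].
have [x0 X0x] : exists x, X0 x by apply/set0P/eqP.
have [[X01 _ _] X0c _] := Fprop _ _ X0F X0x.
have pair x y : (\bigcup_(X in F) X)%classic x -> (\bigcup_(X in F) X)%classic y ->
    exists X, [/\ F X, X x & X y].
  move=> [X XF Xx] [Y YF Yy]; have [XY|YX] := Ftot X Y XF YF.
    by exists Y; split=> //; apply: XY.
  by exists X; split=> //; apply: YX.
split=> [|c cP|].
- split; first by apply/asboolP; exists X0 => //; apply/asboolP.
    move=> x y /asboolP Ux /asboolP Uy; have [X [XF Xx Xy]] := pair x y Ux Uy.
    have [[_ XB _] _ _] := Fprop _ _ XF Xx.
    by apply/asboolP; exists X => //; apply/asboolP/XB; apply/asboolP.
  move=> x y /asboolP Ux /asboolP Uy; have [X [XF Xx Xy]] := pair x y Ux Uy.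
  have [[_ _ XM] _ _] := Fprop _ _ XF Xx.
  by apply/asboolP; exists X => //; apply/asboolP/XM; apply/asboolP.
- by apply/asboolP; exists X0 => //; apply/asboolP/X0c.
apply/asboolP => -[X XF Xt]; have [_ _ /asboolP[]] := Fprop _ _ XF Xt.
exact: Xt.
Qed.

(** Zorn's lemma is applied after adding the empty set, which takes care of the
    empty chain. *)
Lemma maximal_overring : exists2 S : {pred K}, proper_overring S &
  forall B, proper_overring B -> {subset S <= B} -> {subset B <= S}.
Proof.
pose good (A : set K) := (A = set0 \/ proper_overring (fun x => `[< A x >])).
have [F Fgood Ftot|A [gA Amax]] := @Zorn_bigcup _ good.
  have [U0|/existsNP[X /not_implyP[XF X0]]] := pselect (forall X, F X -> X = set0).
    by left; apply/seteqP; split=> x // [X /U0->].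
  by right; apply: union_proper_overring => //; exists X.
have A0 : A <> set0.
  move=> A0; have := constants_proper_overring; set C := (fun x : K => _) => hC.
  have [[C1 _ _] _ _] := hC.
  apply: (Amax [set x | C x]%classic).
    rewrite A0 properEneq; split; last exact: sub0set.
    by apply/eqP => /seteqP[_ /(_ 1)]; apply.
  right; rewrite (_ : (fun x => _) = C) //.
  by apply/funext => x; apply: asboolb.
case: gA => // gA; exists (fun x => `[< A x >]) => // B gB AB x xB.
have [//|Ax] := boolP (x \in (fun x => `[< A x >])).
exfalso; apply: (Amax [set x | x \in B]%classic).
  rewrite properEneq; split.
    by apply/eqP => AE; move/asboolP: Ax; apply; rewrite AE.
  by move=> z Az; apply: AB; apply/asboolP.
right; rewrite (_ : (fun x => _) = B) //.
by apply/funext => z; apply: asboolb.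
Qed.

End ChevalleyExtension.

Section MaximalOverring.
Variables (k0 k : fieldType) (iota : {rmorphism k0 -> k}) (K : fieldExtType k).
Variable P : place iota.
Let t : K := (uniformizer P)%:A.
Let t0 : t != 0. Proof. by rewrite in_alg_eq0 uniformizer_neq0. Qed.

Variable S : subringClosed K.
Hypothesis S_proper : proper_overring P S.
Hypothesis S_maximal :
  forall B : {pred K}, proper_overring P B -> {subset S <= B} -> {subset B <= S}.

Let S_const c : c \in vring P -> c%:A \in S. Proof. by case: S_proper => _ + _; apply. Qed.
Let S_tV : t^-1 \notin S. Proof. by case: S_proper. Qed.
Let S_t : t \in S. Proof. exact/S_const/videal_sub/uniformizer_videal. Qed.

(** Localizing at [1 + t S] keeps [t] non-invertible, so by maximality these
    elements are already units. *)
Lemma maximal_overring_local b : b \in S ->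
  1 + t * b != 0 /\ (1 + t * b)^-1 \in S.
Proof.
have ne c : c \in S -> 1 + t * c != 0.
  move=> cS; apply: contra S_tV => /eqP/(canRL (addrK _)); rewrite sub0r => h.
  have -> : t^-1 = - c by apply: (mulfI t0); rewrite divff // mulrN -h.
  by rewrite rpredN.
move=> bS; split; first exact: ne.
pose B := fun x : K => `[< exists a c, [/\ a \in S, c \in S & x = a / (1 + t * c)] >].
apply: (S_maximal (B := B)); last 2 first.
- by move=> a aS; apply/asboolP; exists a, 0; rewrite mulr0 addr0 divr1 rpred0.
- by apply/asboolP; exists 1, b; rewrite rpred1 mul1r.
split; first split.
- by apply/asboolP; exists 1, 0; rewrite mulr0 addr0 divr1 rpred0 rpred1.
- move=> _ _ /asboolP[a [c [aS cS ->]]] /asboolP[a' [c' [aS' cS' ->]]].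
  have := ne _ cS; have := ne _ cS' => h' h.
  apply/asboolP; exists (a * (1 + t * c') - a' * (1 + t * c)), (c + c' + t * c * c').
  split; first by rewrite !(rpredB, rpredM, rpredD, rpred1).
    by rewrite !(rpredD, rpredM).
  have -> : 1 + t * (c + c' + t * c * c') = (1 + t * c) * (1 + t * c') by ring.
  by field; rewrite h h'.
- move=> _ _ /asboolP[a [c [aS cS ->]]] /asboolP[a' [c' [aS' cS' ->]]].
  have := ne _ cS; have := ne _ cS' => h' h.
  apply/asboolP; exists (a * a'), (c + c' + t * c * c').
  split; first by rewrite rpredM.
    by rewrite !(rpredD, rpredM).
  have -> : 1 + t * (c + c' + t * c * c') = (1 + t * c) * (1 + t * c') by ring.
  by field; rewrite h h'.
- move=> c cP; apply/asboolP; exists c%:A, 0.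
  by rewrite mulr0 addr0 divr1 rpred0; split=> //; apply: S_const.
apply/asboolP => -[a [c [aS cS tE]]]; move/negP: S_tV; apply.
have h := ne _ cS.
have -> : t^-1 = a - c; last by rewrite rpredB.
apply: (mulfI t0); rewrite divff //.
have : t * a = 1 + t * c.
  have -> : a = t^-1 * (1 + t * c) by rewrite tE divfK.
  by rewrite mulrA divff // mul1r.
by rewrite mulrBr => ->; rewrite addrK.
Qed.

(** By maximality, the strictly larger ring [S[x]] contains the inverse of
    [t]. *)
Lemma maximal_overring_adjoin x : x \notin S ->
  exists2 G : {poly K}, G \is a polyOver S & t * G.[x] = 1.
Proof.
move=> xNS; pose B := fun z : K => `[< exists2 G : {poly K}, G \is a polyOver S & z = G.[x] >].
have [/asboolP[G GS tG]|tNB] := boolP (t^-1 \in B).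
  by exists G => //; rewrite -tG divff.
exfalso; move/negP: xNS; apply; apply: (S_maximal (B := B)); last 2 first.
- by move=> a aS; apply/asboolP; exists a%:P; rewrite ?polyOverC ?hornerC.
- by apply/asboolP; exists 'X; rewrite ?polyOverX ?hornerX.
split=> //; last first.
  by move=> c cP; apply/asboolP; exists (c%:A)%:P; rewrite ?polyOverC ?hornerC ?S_const.
split.
- by apply/asboolP; exists 1; rewrite ?rpred1 ?hornerC.
- move=> _ _ /asboolP[G GS ->] /asboolP[H HS ->]; apply/asboolP.
  by exists (G - H); rewrite ?rpredB // hornerD hornerN.
- move=> _ _ /asboolP[G GS ->] /asboolP[H HS ->]; apply/asboolP.
  by exists (G * H); rewrite ?rpredM // hornerM.
Qed.

(** Chevalley's degree argument: since [1 - t h_0] is a unit, the relation of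
    lower degree rewrites the leading term of the other one. *)
Lemma maximal_overring_no_relations x (G H : {poly K}) : x != 0 ->
  G \is a polyOver S -> H \is a polyOver S ->
  t * G.[x] = 1 -> t * H.[x^-1] <> 1.
Proof.
have [N] := ubnP (size G + size H); elim: N x G H => // N IH x G H ltN x0 GS HS Gx Hx.
wlog le_HG : x G H ltN x0 GS HS Gx Hx / (size H <= size G)%N.
  move=> hw; have [|/ltnW le_GH] := leqP (size H) (size G); first exact: (hw x G H).
  by apply: (hw x^-1 H G); rewrite ?invr_eq0 ?invrK // addnC.
have [G0|G0] := eqVneq G 0.
  by move/eqP: Gx; rewrite G0 horner0 mulr0 eq_sym oner_eq0.
have [h|h] := eqVneq H 0.
  by move/eqP: Hx; rewrite h horner0 mulr0 eq_sym oner_eq0.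
have sG : (0 < size G)%N by rewrite size_poly_gt0.
have sH : (0 < size H)%N by rewrite size_poly_gt0.
pose n := (size G).-1; pose m := (size H).-1.
have le_mn : (m <= n)%N by rewrite /m /n; case: (size H) (size G) sH sG le_HG => [|?] [|?].
have GSi i : G`_i \in S by move/polyOverP: GS; apply.
have HSi i : H`_i \in S by move/polyOverP: HS; apply.
have Nh0 : - H`_0 \in S by rewrite rpredN.
have [] := maximal_overring_local Nh0; set u := 1 + _ => u0 uV.
(* [t * W(x) = u * x^n]: the relation for [x^-1], multiplied by [x^n] *)
pose W := \sum_(j < m) (H`_(j.+1))%:P * 'X^(n - j.+1).
have Wx : t * W.[x] = u * x ^+ n.
  have -> : u = t * (H.[x^-1] - H`_0) by rewrite mulrBr Hx /u mulrN.
  rewrite -mulrA; congr (_ * _).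
  rewrite (horner_coef H) -/m -(prednK sH) -/m big_ord_recl expr0 mulr1 addrC addKr.
  rewrite horner_sum mulr_suml; apply: eq_bigr => j _.
  rewrite hornerCM hornerXn -mulrA; congr (_ * _).
  have le_jn : (j.+1 <= n)%N by apply: leq_trans le_mn.
  by rewrite exprVn -[in RHS](subnK le_jn) exprD mulrC mulfK ?expf_neq0.
pose G' := G - lead_coef G *: 'X^n + (t * u^-1 * lead_coef G)%:P * W.
have G'x : G'.[x] = G.[x].
  rewrite /G' hornerD hornerCM hornerD hornerN hornerZ hornerXn.
  have -> : t * u^-1 * lead_coef G * W.[x] = lead_coef G * x ^+ n; last by rewrite subrK.
  transitivity (u^-1 * lead_coef G * (t * W.[x])); first by ring.
  by rewrite Wx; field.
have WS : W \is a polyOver S.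
  by apply: rpred_sum => j _; rewrite rpredM ?polyOverC ?rpredX ?polyOverX.
have cS : lead_coef G \in S by rewrite lead_coefE.
have G'S : G' \is a polyOver S.
  rewrite rpredD ?rpredM // ?polyOverC ?rpredM //.
  by rewrite rpredB // -mul_polyC rpredM ?polyOverC ?rpredX ?polyOverX.
have szG' : (size G' < size G)%N.
  rewrite -[X in (_ < X)%N](prednK sG) ltnS.
  apply: leq_trans (size_polyD _ _) _; rewrite geq_max size_sub_lead /=.
  rewrite mul_polyC; apply: leq_trans (size_scale_leq _ _) _.
  apply: leq_trans (size_sum _ _ _) _; apply/bigmax_leqP => j _.
  rewrite mul_polyC; apply: leq_trans (size_scale_leq _ _) _.
  have le_jn : (j.+1 <= n)%N by apply: leq_trans le_mn.
  by rewrite size_polyXn -/n; move: le_jn; clear; lia.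
apply: (IH x G' H) => //; last by rewrite G'x.
by move: ltN szG'; clear; lia.
Qed.

Lemma maximal_overring_valuation x : x != 0 -> x \in S \/ x^-1 \in S.
Proof.
move=> x0; have [xS|/maximal_overring_adjoin[G GS Gx]] := boolP (x \in S); first by left.
have [xS|/maximal_overring_adjoin[H HS Hx]] := boolP (x^-1 \in S); first by right.
by case: (maximal_overring_no_relations x0 GS HS Gx Hx).
Qed.

Lemma maximal_overring_constants c : c%:A \in S -> c \in vring P.
Proof.
move=> cS; have [->|c0] := eqVneq c 0; first exact: vring0.
have u0 := uniformizer_neq0 P.
rewrite vringE // leNgt; apply: contra S_tV => oc.
have dP : (uniformizer P * c)^-1 \in vring P.
  rewrite vringE ?invr_eq0 ?mulf_neq0 // ordV ?mulf_neq0 // ordM // ord_uniformizer.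
  by move: oc; move: (ord P c); lia.
have -> : t^-1 = c%:A * ((uniformizer P * c)^-1)%:A.
  by rewrite -in_algM -in_algV invfM mulrCA divff // mulr1.
by rewrite rpredM // S_const.
Qed.

End MaximalOverring.

Section DiscreteValuationRing.
Variables (k0 k : fieldType) (iota : {rmorphism k0 -> k}) (K : fieldExtType k).
Variable P : place iota.
Let t : K := (uniformizer P)%:A.
Let t0 : t != 0. Proof. by rewrite in_alg_eq0 uniformizer_neq0. Qed.

Variable S : subringClosed K.
Hypothesis S_val : forall x, x != 0 -> x \in S \/ x^-1 \in S.
Hypothesis S_const : forall c, (c%:A \in S) = (c \in vring P).

Definition nonunit := [pred x : K | (x \in S) && (x^-1 \notin S)].

Let nonunit_sub x : x \in nonunit -> x \in S. Proof. by case/andP. Qed.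

Let nonunit_neq0 x : x \in nonunit -> x != 0.
Proof. by case/andP=> xS; apply: contraNneq => x0; rewrite x0 invr0 -x0. Qed.

Let nonunit_const c : c != 0 -> (c%:A \in nonunit) = (c \in videal P).
Proof.
move=> c0; rewrite inE -in_algV !S_const !vringE ?invr_eq0 // videalE // ordV //.
by rewrite oppr_ge0 -ltNge; case: (ltP 0 (ord P c)) => [/ltW->|]; rewrite ?andbF.
Qed.

Let nonunit_t : t \in nonunit.
Proof. by rewrite nonunit_const ?uniformizer_neq0 // uniformizer_videal. Qed.

(** In a valuation ring, either [x / (1 + x r)] or its inverse is integral; the
    latter equals [x^-1 + r], which is not. *)
Lemma nonunit_local x r : x \in nonunit -> r \in S ->
  1 + x * r != 0 /\ (1 + x * r)^-1 \in S.
Proof.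
move=> xn rS; have x0 := nonunit_neq0 xn; have [xS xV] := andP xn.
have z0 : 1 + x * r != 0.
  apply: contra xV => /eqP/(canRL (addrK _)); rewrite sub0r => h.
  have -> : x^-1 = - r by apply: (mulfI x0); rewrite divff // mulrN -h.
  by rewrite rpredN.
split=> //; set z := 1 + x * r in z0 *.
have xz0 : x / z != 0 by rewrite mulf_neq0 ?invr_eq0.
have -> : z^-1 = 1 - (x / z) * r.
  by apply: (mulIf z0); rewrite mulVf // mulrBl mul1r mulrAC divfK // /z addrK.
rewrite rpredB ?rpred1 // rpredM //.
have [//|] := S_val xz0; rewrite invfM invrK => h; case/negP: xV.
have -> : x^-1 = x^-1 * z - r by rewrite mulrDr mulr1 mulKf // addrK.
by rewrite rpredB.
Qed.

(** Strip the factors [X] from the minimal polynomial of [x] and divide by a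
    coefficient of least valuation. *)
Lemma primitive_relation x : x != 0 -> exists q : {poly k},
  [/\ (map_poly (in_alg K) q).[x] = 0, (size q <= (\dim {:K}).+1)%N,
      q \is a polyOver (vring P), q`_0 != 0 & exists i, q`_i \notin videal P].
Proof.
move=> x0.
have [q0 q0E] := polyOver1P (minPolyOver 1 x).
have strip (q : {poly k}) : q != 0 -> (map_poly (in_alg K) q).[x] = 0 ->
    exists r : {poly k}, [/\ (map_poly (in_alg K) r).[x] = 0,
      (size r <= size q)%N & r`_0 != 0].
  elim/poly_ind: q => [|q c IH]; first by rewrite eqxx.
  have [->|c0] := eqVneq c 0; last first.
    by exists (q * 'X + c%:P); rewrite coefD coefMX coefC eqxx add0r.
  rewrite addr0 mulf_eq0 polyX_eq0 orbF => qn0.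
  rewrite rmorphM /= map_polyX hornerM hornerX => /eqP.
  rewrite mulf_eq0 (negPf x0) orbF => /eqP/(IH qn0)[r [rx szr r0]].
  by exists r; split=> //; rewrite size_mulX // ltnW.
have qn0 : q0 != 0.
  apply/eqP => q00; have := monic_neq0 (monic_minPoly 1 x).
  by rewrite q0E q00 rmorph0 eqxx.
have qx : (map_poly (in_alg K) q0).[x] = 0 by rewrite -q0E minPolyxx.
have szq : (size q0 <= (\dim {:K}).+1)%N.
  rewrite -(size_map_poly (in_alg K)) -q0E size_minPoly ltnS.
  rewrite adjoin_degreeE dimv1 divn1; exact: dimvS (subvf _).
have [r [rx szr r0]] := strip q0 qn0 qx.
have rn0 : r != 0 by apply: contraNneq r0 => ->; rewrite coef0.
have sr : (0 < size r)%N by rewrite size_poly_gt0.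
pose i0 : 'I_(size r) := Ordinal sr.
have [j rj jmin] := @arg_minP _ _ _ i0 (fun i : 'I_(size r) => r`_i != 0)
  (fun i => ord P r`_i) r0.
exists ((r`_j)^-1 *: r); split.
- by rewrite linearZ /= hornerZ rx mulr0.
- by rewrite size_scale ?invr_eq0 // (leq_trans szr).
- apply/polyOverP => i; rewrite coefZ.
  have [->|ri0] := eqVneq r`_i 0; first by rewrite mulr0 vring0.
  have ri : (i < size r)%N by apply: contraNT ri0; rewrite -leqNgt => /(nth_default 0)->.
  rewrite vringE ?mulf_neq0 ?invr_eq0 // ordM ?invr_eq0 // ordV //.
  by rewrite addrC subr_ge0; apply: (jmin (Ordinal ri)).
- by rewrite coefZ mulf_neq0 ?invr_eq0.
exists j; rewrite coefZ mulVf // videalE ?oner_neq0 // ord1 ltxx //.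
Qed.

Let horner_S (q : {poly k}) x : q \is a polyOver (vring P) -> x \in S ->
  (map_poly (in_alg K) q).[x] \in S.
Proof.
move=> /polyOverP qP xS; apply: rpred_horner => //.
by apply/polyOverP => i; rewrite coef_map /= S_const.
Qed.

(** Reducing a primitive relation modulo [t]: if [q_i] is the first unit
    coefficient, then a unit times [x^i] lies in [t S]. *)
Lemma nonunit_power x : x \in nonunit -> x ^+ (\dim {:K}) / t \in S.
Proof.
move=> xn; have x0 := nonunit_neq0 xn; have xS := nonunit_sub xn.
have [q [qx szq /polyOverP qP q0 exi]] := primitive_relation x0.
case: (ex_minnP exi) => i qi imin.
have [qi0 oqi] := ord_unit (qP i) qi.
have lt_i : (i <= \dim {:K})%N.
  rewrite -ltnS; apply: leq_trans szq; apply: contraNT qi0.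
  by rewrite -leqNgt => /(nth_default 0)->.
have u0 : (q`_i)%:A != 0 :> K by rewrite in_alg_eq0.
have uV : ((q`_i)%:A)^-1 \in S by rewrite -in_algV S_const vringV.
pose A := (uniformizer P)^-1 *: take_poly i q; pose B := drop_poly 1 (drop_poly i q).
have AP : A \is a polyOver (vring P).
  apply/polyOverP => j; rewrite coefZ coef_take_poly mulrC.
  apply: videal_divuniformizer; case: ltnP => [lt_ji|_]; last exact: videal0.
  by apply: contraTT lt_ji => /imin; rewrite leqNgt.
have BP : B \is a polyOver (vring P).
  by apply/polyOverP => j; rewrite !coef_drop_poly.
have qE : q = uniformizer P *: A + (B * 'X + (q`_i)%:P) * 'X^i.
  rewrite scalerKV ?uniformizer_neq0 // -{1}(poly_take_drop i q).
  congr (_ + _ * _); rewrite -{1}(poly_take_drop 1 (drop_poly i q)) addrC expr1.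
  congr (_ + _); apply/polyP => j; rewrite coef_take_poly coefC coef_drop_poly.
  by case: j.
clearbody A B; have BuS : (map_poly (in_alg K) B).[x] * ((q`_i)%:A)^-1 \in S.
  by rewrite rpredM ?horner_S.
have [v0 vV] := nonunit_local xn BuS.
move: v0 vV; set b := (map_poly _ B).[x]; set v := 1 + _ => v0 vV.
have rel : x ^+ i = - (t * (map_poly (in_alg K) A).[x]) * ((q`_i)%:A)^-1 * v^-1.
  have uv : (q`_i)%:A * v = b * x + (q`_i)%:A by rewrite /v; field.
  have qx' : t * (map_poly (in_alg K) A).[x] + (q`_i)%:A * v * x ^+ i = 0.
    rewrite uv -[RHS]qx {2}qE.
    rewrite rmorphD /= map_polyZ rmorphM rmorphD rmorphM /= map_polyX map_polyXn map_polyC.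
    by rewrite hornerD hornerZ hornerM hornerD hornerM hornerX hornerC hornerXn.
  apply: (mulfI (mulf_neq0 u0 v0)); move/eqP: qx'; rewrite addrC addr_eq0 => /eqP->.
  by field; rewrite u0 v0.
rewrite -(subnK lt_i) exprD rel.
set d := (\dim {:K} - i)%N; set c := (map_poly _ A).[x].
have -> : x ^+ d * (- (t * c) * ((q`_i)%:A)^-1 * v^-1) / t
    = - (x ^+ d * c * ((q`_i)%:A)^-1 * v^-1).
  by field; rewrite t0 u0 v0.
by rewrite rpredN !rpredM ?rpredX ?horner_S.
Qed.

(** The constant term of a relation satisfied by [x] is a multiple of [x]. *)
Lemma divides_constant x : x \in S -> x != 0 ->
  exists s : nat, t ^+ s / x \in S.
Proof.
move=> xS x0; have [q [qx _ /polyOverP qP q0 _]] := primitive_relation x0.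
have oq : 0 <= ord P q`_0 by rewrite -vringE.
pose s := `|ord P q`_0|%N; exists s.
have sP : uniformizer P ^+ s / q`_0 \in vring P.
  have u0 := uniformizer_neq0 P.
  rewrite vringE ?mulf_neq0 ?invr_eq0 ?expf_neq0 // ordM ?invr_eq0 ?expf_neq0 //.
  by rewrite ordX // ordV // ord_uniformizer natz /s gez0_abs // subrr.
have dP : drop_poly 1 q \is a polyOver (vring P).
  by apply/polyOverP => j; rewrite coef_drop_poly.
have qE : q = drop_poly 1 q * 'X + (q`_0)%:P.
  rewrite -{1}(poly_take_drop 1 q) addrC expr1; congr (_ + _).
  by apply/polyP => -[|j]; rewrite coef_take_poly coefC.
have q0x : (q`_0)%:A / x \in S.
  have : (map_poly (in_alg K) (drop_poly 1 q)).[x] * x + (q`_0)%:A = 0.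
    rewrite -[RHS]qx {3}qE rmorphD rmorphM /= map_polyX map_polyC.
    by rewrite hornerD hornerM hornerX hornerC.
  move/eqP; rewrite addrC addr_eq0 => /eqP->.
  by rewrite mulNr mulfK // rpredN horner_S.
have qA0 : (q`_0)%:A != 0 :> K by rewrite in_alg_eq0.
have -> : t ^+ s / x = (uniformizer P ^+ s / q`_0)%:A * ((q`_0)%:A / x).
  by rewrite in_algM in_algV in_algX mulrA divfK.
by rewrite rpredM // S_const.
Qed.

(** The generator is a nonunit [w] with [w^i] dividing [t] for the largest
    possible [i], which exists by [nonunit_power].  A nonunit [x] not divisible by
    [w] would give a factorization of [w] into two nonunits, one of which divides
    the other, so that its square divides [w] and its power [2 i] divides [t]. *)
Lemma nonunit_generator : exists2 w, w \in nonunit &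
  forall x, x \in nonunit -> x / w \in S.
Proof.
pose E i := `[< exists2 w, w \in nonunit & t / w ^+ i \in S >].
have E1 : E 1%N by apply/asboolP; exists t => //; rewrite expr1 divff // rpred1.
have exE : exists i, E i by exists 1%N.
have Ebound i : E i -> (i <= \dim {:K})%N.
  move=> /asboolP[w wn twS]; rewrite leqNgt; apply/negP => lt_i.
  have w0 := nonunit_neq0 wn; have [wS /negP] := andP wn; apply.
  pose d := \dim {:K}; pose r := (i - d.+1)%N.
  have iE : i = (d + r.+1)%N by rewrite /r /d; move: lt_i; clear; lia.
  have -> : w^-1 = (t / w ^+ i) * (w ^+ d / t) * w ^+ r.
    by rewrite iE exprD exprS; field; rewrite t0 w0 !expf_neq0.
  by apply: rpredM; [apply: rpredM => //; exact: nonunit_power | exact: rpredX].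
case: (ex_maxnP exE Ebound) => i /asboolP[w wn twS] imax; exists w => // x xn.
have i0 : (0 < i)%N by apply: imax.
have [w0 x0] := (nonunit_neq0 wn, nonunit_neq0 xn).
have wx0 : w / x != 0 by rewrite mulf_neq0 ?invr_eq0.
have [//|xwN] := boolP (x / w \in S); exfalso.
have vn : w / x \in nonunit.
  have vV : (w / x)^-1 \notin S by rewrite invfM invrK mulrC.
  by rewrite inE vV andbT; have [//|h] := S_val wx0; rewrite h in vV.
have sq y : y \in nonunit -> w / y ^+ 2 \in S -> False.
  move=> yn wy; have y0 := nonunit_neq0 yn.
  suff /imax : E (2 * i)%N by rewrite leqNgt; case/negP; move: i0; clear; lia.
  apply/asboolP; exists y => //.
  have -> : t / y ^+ (2 * i) = (t / w ^+ i) * (w / y ^+ 2) ^+ i.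
    by rewrite exprM expr_div_n mulrA divfK ?expf_neq0.
  by rewrite rpredM ?rpredX.
have xv0 : x / (w / x) != 0 by rewrite mulf_neq0 ?invr_eq0.
have [h|h] := S_val xv0.
  by apply: (sq _ vn); rewrite (_ : w / _ = x / (w / x)) //; field; rewrite x0 w0.
by apply: (sq _ xn); rewrite (_ : w / _ = (x / (w / x))^-1) //; field; rewrite x0 w0.
Qed.

Lemma dvr_order : exists2 w, w \in nonunit &
  forall x, x != 0 -> exists z : int, x / w ^ z \in S /\ (x / w ^ z)^-1 \in S.
Proof.
have [w wn wgen] := nonunit_generator; exists w => //.
have w0 := nonunit_neq0 wn; have wS := nonunit_sub wn.
have pos m x : x \in S -> x != 0 -> w ^+ m / x \in S ->
    exists j : nat, x / w ^+ j \in S /\ (x / w ^+ j)^-1 \in S.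
  elim: m x => [|m IH] x xS x0 wmx.
    by exists 0%N; rewrite expr0 divr1; split=> //; rewrite expr0 mul1r in wmx.
  have [xV|xV] := boolP (x^-1 \in S); first by exists 0%N; rewrite expr0 divr1.
  have xwS : x / w \in S by apply: wgen; rewrite inE xS.
  have xw0 : x / w != 0 by rewrite mulf_neq0 ?invr_eq0.
  have [|j jP] := IH _ xwS xw0.
    by rewrite (_ : _ / _ = w ^+ m.+1 / x) // exprS; field; rewrite x0 w0.
  exists j.+1; rewrite (_ : x / w ^+ j.+1 = x / w / w ^+ j) //.
  by rewrite exprS invfM mulrA.
have posS x : x \in S -> x != 0 ->
    exists j : nat, x / w ^+ j \in S /\ (x / w ^+ j)^-1 \in S.
  move=> xS x0; have [s sP] := divides_constant xS x0.
  apply: (pos (\dim {:K} * s)%N) => //.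
  have -> : w ^+ (\dim {:K} * s) / x = (w ^+ (\dim {:K}) / t) ^+ s * (t ^+ s / x).
    by rewrite exprM expr_div_n mulrA divfK ?expf_neq0.
  by rewrite rpredM ?rpredX ?nonunit_power.
move=> x x0; have [xS|xS] := S_val x0.
  by have [j jP] := posS x xS x0; exists j%:Z.
have xV0 : x^-1 != 0 by rewrite invr_eq0.
have [j [j1 j2]] := posS _ xS xV0; exists (- j%:Z).
rewrite -exprnN invrK; split; last by rewrite invfM.
by move: j2; rewrite invfM !invrK.
Qed.

Lemma dvr_place : exists Q : place_above iota K, lies_over Q P.
Proof.
have [w wn wP] := dvr_order.
have w0 := nonunit_neq0 wn; have [wS wV] := andP wn.
have /choice[ord' ordP] : forall x, exists z : int, x != 0 ->
    x / w ^ z \in S /\ (x / w ^ z)^-1 \in S.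
  move=> x; have [->|x0] := eqVneq x 0; first by exists 0.
  by have [z zP] := wP x x0; exists z.
have wz0 z : w ^ z != 0 by rewrite expfz_neq0.
have key x a : x != 0 -> (x / w ^ a \in S) = (a <= ord' x).
  move=> x0; have [U1 U2] := ordP x x0.
  have [le_a|lt_a] := leP a (ord' x).
    have -> : x / w ^ a = x / w ^ ord' x * w ^+ `|ord' x - a|%N.
      have wE : w ^ ord' x = w ^ a * w ^+ `|ord' x - a|%N.
        by rewrite [w ^+ _]exprnP -expfzDr // gez0_abs ?subr_ge0 // subrKC.
      by rewrite wE; field; rewrite wz0 expf_neq0.
    by rewrite rpredM ?rpredX.
  apply/negP => xaS; case/negP: wV.
  pose r := `|(a - ord' x - 1)%R|%N.
  have aE : a = ord' x + 1 + r%:Z by rewrite /r; move: lt_a; clear; lia.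
  have -> : w^-1 = (x / w ^ a) * (x / w ^ ord' x)^-1 * w ^+ r.
    rewrite aE !expfzDr // expr1z -exprnP; field.
    by rewrite x0 w0 wz0 expf_neq0.
  by apply: rpredM; [exact: rpredM | exact: rpredX].
have keyE x a : x != 0 -> x / w ^ a \in S -> (x / w ^ a)^-1 \in S -> ord' x = a.
  move=> x0 h1 h2; apply/eqP; rewrite eq_sym eq_le -key // h1 /= leNgt.
  rewrite -lezD1 -key //; apply/negP => h3; case/negP: wV.
  have -> : w^-1 = (x / w ^ (a + 1)) * (x / w ^ a)^-1.
    by rewrite expfzDr // expr1z; field; rewrite x0 w0 wz0.
  by rewrite rpredM.
pose val (x : K) : \bar int := if x == 0 then +oo%E else (ord' x)%:E.
have valE x : x != 0 -> val x = (ord' x)%:E by rewrite /val => /negPf->.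
have val0 : val 0 = +oo%E by rewrite /val eqxx.
have ord'M x y : x != 0 -> y != 0 -> ord' (x * y) = ord' x + ord' y.
  move=> x0 y0; have [[x1 x2] [y1 y2]] := (ordP x x0, ordP y y0).
  have E : x * y / w ^ (ord' x + ord' y) = (x / w ^ ord' x) * (y / w ^ ord' y).
    by rewrite expfzDr // invfM mulrACA.
  apply: keyE; [exact: mulf_neq0 | rewrite E; exact: rpredM |].
  by rewrite E (invfM (x / _)); apply: rpredM.
have valM x y : val (x * y) = (val x + val y)%E.
  have [->|x0] := eqVneq x 0.
    by rewrite mul0r val0 /val; case: eqP.
  have [->|y0] := eqVneq y 0.
    by rewrite mulr0 val0 valE.
  by rewrite !valE ?mulf_neq0 // ord'M.
have valD x y : (Order.min (val x) (val y) <= val (x + y)%R)%E.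
  have [->|x0] := eqVneq x 0; first by rewrite add0r ge_min lexx orbT.
  have [->|y0] := eqVneq y 0; first by rewrite addr0 ge_min lexx.
  have [->|xy0] := eqVneq (x + y) 0; first by rewrite val0 leey.
  rewrite !valE // -EFin_min lee_fin -key // mulrDl rpredD // key //.
    by rewrite ge_min lexx.
  by rewrite ge_min lexx orbT.
have valfin x : x != 0 -> val x \is a fin_num by move=> x0; rewrite valE.
have valn : exists z, val z == 1%:E.
  exists w; rewrite valE //; apply/eqP; congr (_%:E).
  by apply: keyE => //; rewrite expr1z divff // ?invr1 rpred1.
have val_unit c : c != 0 -> ord P c = 0 -> val c%:A = 0%E.
  move=> c0 oc; rewrite valE ?in_alg_eq0 //; congr (_%:E).
  apply: keyE; rewrite ?in_alg_eq0 // expr0z divr1 -?in_algV S_const vringE ?invr_eq0 //.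
    by rewrite oc.
  by rewrite ordV // oc.
have valc : forall d : k0, d != 0 -> val (iota d)%:A = 0%E.
  by move=> d d0; apply: val_unit; rewrite ?fmorph_eq0 // const_ord ?fmorph_eq0.
exists (Place val0 valfin valM valD valn valc) => x /=.
have [->|x0] := eqVneq x 0; first by rewrite scale0r val0 valuation0 !ltry.
have xA0 : x%:A != 0 :> K by rewrite in_alg_eq0.
have ord'1 : ord' 1 = 0.
  by apply: keyE; rewrite ?oner_neq0 // expr0z divr1 ?invr1 rpred1.
have ord'V : ord' (x%:A)^-1 = - ord' x%:A.
  by apply/eqP; rewrite -addr_eq0 -ord'M ?invr_eq0 // mulVf // ord'1.
rewrite valE // lte_fin ltNge -oppr_ge0 -ord'V -key ?invr_eq0 // expr0z divr1.
by rewrite -in_algV S_const vringE ?invr_eq0 // ordV // oppr_ge0 -ltNge place_gt0.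
Qed.

End DiscreteValuationRing.

(** Chevalley's extension theorem yields a valuation ring of [K] over that of
    [P]; it is discrete because [K] has finite degree over [k]. *)
Theorem exists_place_above (k0 k : fieldType) (iota : {rmorphism k0 -> k})
    (K : fieldExtType k) (P : place iota) :
  exists Q : place_above iota K, lies_over Q P.
Proof.
have [S0 S0p S0max] := maximal_overring K P.
have [Ssub Sc StV] := S0p.
pose S := subringClosed_of Ssub.
have Sp : proper_overring P S := S0p.
have Smax B : proper_overring P B -> {subset S <= B} -> {subset B <= S} := S0max B.
apply: (@dvr_place _ _ _ _ P S).
  by move=> x; apply: (maximal_overring_valuation Sp Smax).
move=> c; apply/idP/idP; first exact: (maximal_overring_constants Sp).
by case: Sp => _ + _; apply.
Qed.

(** * The ramification behaviour of a place *)

Section Ramification.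
Variables (k0 k : fieldType) (iota : {rmorphism k0 -> k}) (K : fieldExtType k).
Variables (p n : nat) (charp : p \in [pchar k0]) (hn : (0 < n)%N).
Variables (a : 'I_n -> k0) (a0 : a (Ordinal hn) != 0).
Let f := additive_polynomial p a.
Let j : {rmorphism k0 -> K} := in_alg K \o iota.
Variables (P : place iota) (y : K) (u : k).
Hypothesis yu : generated_by iota f y u.

Let fjE : map_poly (in_alg K) (map_poly iota f) = map_poly j f.
Proof. by rewrite -map_poly_comp. Qed.

Let fy : (map_poly j f).[y] = u%:A. Proof. by rewrite -fjE; case: yu. Qed.

Let iota_int c : iota c \in vring P.
Proof.
have [->|c0] := eqVneq c 0; first by rewrite rmorph0 vring0.
by rewrite inE (valuation_constant P c0).
Qed.

(** A pole of [y] would be a pole of [f(y) = u]. *)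
Lemma generator_vring (Q : place_above iota K) :
  u%:A \in vring Q -> y \in vring Q.
Proof.
have [->|y0] := eqVneq y 0; first by rewrite vring0.
move=> uQ; rewrite vringE // leNgt; apply/negP => oy.
have [_ [w0 ow]] := @ord_additive_polynomial k0 p n charp a K j Q y y0 oy.
move: uQ; rewrite -fy vringE // ow leNgt => /negP[].
by rewrite pmulr_rlt0 // ltz_nat expn_gt0 (prime_gt0 (pcharf_prime charp)).
Qed.

(** The polynomial [f - u] has the roots [y + r], with [r] a root of [f]; their
    differences are nonzero constants, hence units.  So [e] divides the valuation
    of every element of [K], in particular the value [1]. *)
Lemma unramified_of_integral (roots : seq k0) :
  f = \prod_(r <- roots) ('X - r%:P) -> (0 <= P u)%E -> unramified K P.
Proof.
move=> fE Pu Q QP.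
have [roots_uniq roots_size] := uniq_additive_roots charp a0 fE.
have uP : u \in vring P by [].
have y_int : y \in vring Q by apply/generator_vring/(lies_over_vring QP).
have j_int c : j c \in vring Q.
  have [->|c0] := eqVneq c 0; first by rewrite rmorph0 vring0.
  by rewrite inE (valuation_constant Q c0).
have j_unit c : c != 0 -> j c \notin videal Q.
  by move=> c0; rewrite inE (valuation_constant Q c0) ltxx.
pose g := map_poly iota f - u%:P.
have f_monic : map_poly iota f \is monic by rewrite monic_map ?monic_additive_polynomial.
have szf : size (map_poly iota f) = (p ^ n).+1.
  by rewrite size_map_poly size_additive_polynomial.
have ltu : (size (- u%:P) < size (map_poly iota f))%N.
  rewrite size_polyN szf; apply: leq_ltn_trans (size_polyC_leq1 _) _.
  by rewrite ltnS expn_gt0 (prime_gt0 (pcharf_prime charp)).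
have g_monic : g \is monic by rewrite monicE lead_coefDl // -monicE.
have szg : size g = (p ^ n).+1 by rewrite size_polyDl.
have g_int : g \is a polyOver (vring P).
  apply: rpredB; last by rewrite polyOverC.
  by apply/polyOverP => i; rewrite coef_map; apply: iota_int.
have gz z : (map_poly (in_alg K) g).[z] = (map_poly j f).[z] - u%:A.
  by rewrite rmorphB /= fjE map_polyC hornerD hornerN hornerC.
have gy : (map_poly (in_alg K) g).[y] = 0 by rewrite gz fy subrr.
have dgy : (map_poly (in_alg K) g^`()).[y] \notin videal Q.
  rewrite derivB derivC subr0 deriv_map (deriv_additive_polynomial charp _ hn).
  by rewrite !map_polyC hornerC; apply: j_unit.
pose zs := [seq y + j r | r <- roots].
have zs_int : {subset zs <= vring Q}.
  by move=> _ /mapP[r _ ->]; rewrite rpredD.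
have zs_pair : pairwise (fun z z' => z - z' \notin videal Q) zs.
  rewrite pairwise_map; move: roots_uniq; rewrite uniq_pairwise.
  apply: sub_pairwise => r s rs; change (y + j r - (y + j s) \notin videal Q).
  have -> : y + j r - (y + j s) = j (r - s).
    by rewrite (rmorphB j) opprD addrACA subrr add0r.
  by rewrite j_unit // subr_eq0.
have zs_size : size g = (size zs).+1 by rewrite szg size_map roots_size.
have zs_roots : {in zs, forall z, (map_poly (in_alg K) g).[z] = 0}.
  move=> _ /mapP[r rr ->]; rewrite gz additive_polynomialD // fy addrC addKr.
  rewrite horner_map -[RHS](rmorph0 j); congr (j _); apply/eqP.
  by rewrite -/(root f r) fE root_prod_XsubC.
have [t /eqP Qt] := valuation_normalized Q.
have t0 : t != 0 by apply: contra_eq_neq Qt => ->; rewrite valuation0.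
have /Fadjoin_polyP[T' /polyOver1P[T ->] tE] : t \in <<1; y>>%VS.
  by case: yu => -> _; rewrite memvf.
have Ty0 : (map_poly (in_alg K) T).[y] != 0 by rewrite -tE.
have [s] := ramification_index_dvd_ord QP y_int g_monic g_int gy dgy zs_int
  zs_pair zs_size zs_roots Ty0.
rewrite -tE /ord Qt /= => es; apply/eqP; rewrite -dvdn1.
have : (ramification_index Q P %| 1)%Z by apply/dvdzP; exists s; rewrite mulrC.
by rewrite dvdzE.
Qed.

(** Compare both sides of [f(y) = u]: the valuation of the left side is [p^n]
    times that of [y], the valuation of the right side is [- e * l * p^m]. *)
Lemma dvdn_ramification_index (Q : place_above iota K) (l m : nat) :
  lies_over Q P -> coprime l p -> (m < n)%N ->
  P u = (- (l * p ^ m)%N%:Z)%:E -> (p ^ (n - m) %| ramification_index Q P)%N.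
Proof.
move=> QP lp mn Pu; have p_pr := pcharf_prime charp.
set e := ramification_index Q P.
have l0 : (0 < l)%N by case: l lp {Pu} => //; rewrite /coprime gcd0n; case: (p) p_pr => [|[]].
have lpm : (0 < l * p ^ m)%N by rewrite muln_gt0 l0 expn_gt0 prime_gt0.
have u0 : u != 0 by apply: contra_eq_neq Pu => ->; rewrite valuation0.
have ou : ord P u = - (l * p ^ m)%N%:Z by rewrite /ord Pu.
have uA0 : u%:A != 0 :> K by rewrite in_alg_eq0.
have ouQ : ord Q u%:A = - (e * (l * p ^ m))%N%:Z.
  by rewrite (ord_lies_over QP) // ou mulrN -PoszM.
have e0 := ramification_index_gt0 QP.
have yN : y \notin vring Q.
  apply/negP => yv; have : (map_poly j f).[y] \in vring Q.
    rewrite -fjE (horner_vring QP) //; apply/polyOverP => i.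
    by rewrite coef_map; apply: iota_int.
  rewrite fy vringE // ouQ oppr_ge0 lez_nat leqNgt => /negP; apply.
  by rewrite muln_gt0 e0.
have y0 : y != 0 by apply: contraNneq yN => ->; rewrite vring0.
have oy : ord Q y < 0 by move: yN; rewrite vringE // -ltNge.
have [_ [_]] := @ord_additive_polynomial k0 p n charp a K j Q y y0 oy.
rewrite fy ouQ => h.
have hN : (e * (l * p ^ m) = p ^ n * `|ord Q y|)%N.
  by have := congr1 absz h; rewrite abszN abszM !absz_nat.
have dv : (p ^ (n - m) * p ^ m %| e * l * p ^ m)%N.
  by rewrite -expnD subnK ?(ltnW mn) // -mulnA hN dvdn_mulr.
rewrite dvdn_pmul2r ?expn_gt0 ?prime_gt0 // in dv.
by rewrite -(Gauss_dvdl _ (_ : coprime (p ^ (n - m)) l)) // coprimeXl // coprime_sym.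
Qed.

Lemma ramified_of_pole (l m : nat) : coprime l p -> (m < n)%N ->
  P u = (- (l * p ^ m)%N%:Z)%:E -> ramified K P.
Proof.
move=> lp mn Pu; have [Q QP] := exists_place_above K P.
exists Q; split=> //.
have dv := dvdn_ramification_index QP lp mn Pu.
apply: leq_trans (dvdn_leq (ramification_index_gt0 QP) dv).
by rewrite -(expn0 p) ltn_exp2l ?subn_gt0 // prime_gt1 // (pcharf_prime charp).
Qed.

End Ramification.

Theorem theorem5p2
    (k0 k : fieldType) (iota : {rmorphism k0 -> k})
    (p : nat) (hp : p \in [pchar k0])
    (hk : function_field iota) (hk0 : perfect_field k0)
    (n : nat) (hn : (0 < n)%N) (a : 'I_n -> k0) (ha : a (Ordinal hn) != 0)
    (f : {poly k0}) (hf : f = additive_polynomial p a)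
    (roots : seq k0) (hroots : f = \prod_(r <- roots) ('X - r%:P))
    (K : fieldExtType k) (y : K) (u : k) (hy : generated_by iota f y u)
    (hirr : irreducible_poly (map_poly iota f - u%:P))
    (P : place iota) :
  (exists (y' : K) (u' : k), generated_by iota f y' u' /\
     ((0 <= P u')%E \/
      exists l m : nat, [/\ coprime l p, (m < n)%N &
        P u' = (- (l * p ^ m)%N%:Z)%:E])) /\
  (forall (y' : K) (u' : k), generated_by iota f y' u' ->
     ((0 <= P u')%E -> unramified K P) /\
     (forall l m : nat, coprime l p -> (m < n)%N ->
        P u' = (- (l * p ^ m)%N%:Z)%:E ->
        ramified K P /\
        forall Q : place_above iota K, lies_over Q P ->
          (p ^ (n - m) %| ramification_index Q P)%N)).
Proof.
split; last first.
  move=> y' u' yu'; rewrite hf in yu' hroots; split.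
    exact: (unramified_of_integral hp ha yu' hroots).
  move=> l m lp mn Pu'; split; first exact: (ramified_of_pole hp yu' lp mn Pu').
  by move=> Q QP; exact: (dvdn_ramification_index hp yu' QP lp mn Pu').
have [z Hz] := reduce_pole hp hn hk0 hk P a u.
exists (y - z%:A), (u - (map_poly iota f).[z]); split; last by rewrite hf.
have [Ky fy] := hy; split.
  apply/eqP; rewrite eqEsubv subvf -Ky; apply/FadjoinP; rewrite sub1v /=.
  rewrite -[X in X \in _](subrK z%:A y) rpredD ?memv_adjoin //.
  by apply: subvP_adjoin; rewrite rpredZ // mem1v.
pose j : {rmorphism k0 -> K} := in_alg K \o iota.
have fE : map_poly (in_alg K) (map_poly iota f) = map_poly j f by rewrite -map_poly_comp.
rewrite fE hf (additive_polynomialB hp) -hf -fE fy horner_map.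
by rewrite scalerBl.
Qed.
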